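(* Let $G$ be a connected planar graph. Then there are co-bipartite graphs $G_1,G_2,G_3,G_4$, a unit interval graph $G_5$, and a chordal graph $G_6$ such that $G=\bigcap_{i=1}^6 G_i$.
   Context: Graphs are finite, simple and undirected. $G=\bigcap_{i=1}^d G_i$ means that $V(G_i)=V(G)$ for all $i$ and $E(G)=\bigcap_{i=1}^d E(G_i)$. A co-bipartite graph is the complement of a bipartite graph. A unit interval graph is the intersection graph of a family of unit-length intervals on the real line (vertices correspond to intervals, two distinct vertices being adjacent iff their intervals intersect). A graph is chordal if it has no induced (chordless) cycle of length at least four. *)

(* Defs.v *)
From HB Require Import structures.
From mathcomp Require Import all_boot all_order all_algebra.
From mathcomp Require Import all_classical all_reals all_analysis.
Import Order.TTheory GRing.Theory Num.Theory.
Import numFieldNormedType.Exports.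

Set Implicit Arguments.
Unset Strict Implicit.
Unset Printing Implicit Defensive.

Local Open Scope ring_scope.

Record sgraph (V : finType) := SGraph {
  adj :> rel V;
  adj_sym : symmetric adj;
  adj_irrefl : irreflexive adj }.

Definition edges (V : finType) (G : sgraph V) : {set {set V}} :=
  [set [set p.1; p.2]%SET | p : V * V & G p.1 p.2]%SET.

Definition sg_connected (V : finType) (G : sgraph V) : Prop :=
  forall x y : V, connect G x y.

Definition compl_rel (V : finType) (G : sgraph V) : rel V :=
  fun x y => (x != y) && ~~ G x y.

Lemma compl_rel_sym (V : finType) (G : sgraph V) : symmetric (compl_rel G).
Proof. by move=> x y; rewrite /compl_rel eq_sym adj_sym. Qed.

Lemma compl_rel_irrefl (V : finType) (G : sgraph V) :
  irreflexive (compl_rel G).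
Proof. by move=> x; rewrite /compl_rel eqxx. Qed.

Definition sg_compl (V : finType) (G : sgraph V) : sgraph V :=
  SGraph (@compl_rel_sym V G) (@compl_rel_irrefl V G).

Definition bipartite (V : finType) (G : sgraph V) : Prop :=
  exists c : V -> bool, forall x y : V, G x y -> c x != c y.

Definition cobipartite (V : finType) (G : sgraph V) : Prop :=
  exists2 H : sgraph V, bipartite H & G =2 sg_compl H.

(* The intervals are closed, and [l x] is the left endpoint of that of [x]. *)
Definition unit_interval_graph (R : realType) (V : finType) (G : sgraph V) :
    Prop :=
  exists l : V -> R, forall x y : V, x != y ->
    (G x y <-> (`[l x, l x + 1] `&` `[l y, l y + 1] !=set0)%classic).

(* [ordS] is the cyclic successor, so [f] embeds the cycle of length [k] as an
   induced subgraph as soon as [2 < k]. *)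
Definition induced_cycle (V : finType) (G : sgraph V) (k : nat)
    (f : 'I_k -> V) : Prop :=
  injective f /\
  forall i j : 'I_k, G (f i) (f j) = (j == ordS i) || (i == ordS j).

Definition chordal (V : finType) (G : sgraph V) : Prop :=
  forall (k : nat) (f : 'I_k -> V), (4 <= k)%N -> ~ induced_cycle G f.

(* A drawing in the plane without crossings: [pos] places the vertices and
   [arc e], restricted to [0, 1], is a simple curve joining the two ends of the
   edge [e] (in either direction) whose interior contains no vertex and no
   point of another edge. Values of [arc] at non-edges are irrelevant. *)
Definition plane_drawing (R : realType) (V : finType) (G : sgraph V)
    (pos : V -> R * R) (arc : {set V} -> R -> R * R) : Prop :=
  [/\ injective pos,
      forall e : {set V}, e \in edges G ->
        [/\ {within `[0, 1], continuous (arc e)}%classic,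
            {in `[0, 1] &, injective (arc e)} &
            (arc e @` [set 0; 1] = pos @` [set` e])%classic],
      forall (e : {set V}) (v : V) (t : R), e \in edges G ->
        t \in `]0, 1[ -> arc e t <> pos v &
      forall (e f : {set V}) (s t : R), e \in edges G -> f \in edges G ->
        e != f -> s \in `]0, 1[ -> t \in `[0, 1] -> arc e s <> arc f t].

Definition planar (R : realType) (V : finType) (G : sgraph V) : Prop :=
  exists (pos : V -> R * R) (arc : {set V} -> R -> R * R),
    plane_drawing G pos arc.

(* Main.v *)
(* Take breadth-first layers [lay] and a breadth-first tree, and let the unit
   interval graph join the vertices of equal or consecutive layers.  It then
   suffices to find a chordal supergraph with an elimination order in which
   every vertex has at most seven earlier neighbours in its own layer: a greedy
   colouring of each layer with eight colours gives three bits, the parity of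
   the layer a fourth one, and each bit yields a co-bipartite graph whose
   non-edges are the non-edges of [G] between vertices with different bits.
   Two vertices that no such graph separates have the same layer and colour, so
   they are adjacent in the chordal graph only if they are adjacent in [G].

   The elimination order comes from separators that are unions of at most six
   vertical paths of the tree, each of which meets a layer at most once.  A
   region [X] is bounded by two disjoint subtrees [A] and [B], each made of two
   vertical paths, which are joined at both ends by edges or outside paths.  An
   edge across which the vertical paths change from ending in [A] to ending in
   [B] gives a path of [X] from [A] to [B]; a component of the rest of [X] that
   touched the boundary on both sides of this path would give a K33 minor, so
   every component is again such a region.  K33-minor-freeness is the only
   consequence of planarity that is used.

   A plane drawing excludes K33 minors by a parity argument in the style of
   Hanani and Tutte: approximate the arcs by polygons such that disjoint edges
   keep disjoint polygons; for two disjoint polygons, the order of their end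
   points is determined modulo 2 by how often each one passes above the ends of
   the other, and adding up these relations over all pairs of independent edges
   of K33 gives 1 = 0. *)
Require Import Defs.
From HB Require Import structures.
From mathcomp Require Import all_boot all_order all_algebra.
From mathcomp Require Import all_classical all_reals all_analysis.
From mathcomp Require Import ring lra.
(* [all_classical] shadows the finite-set lemmas and notations. *)
From mathcomp Require Import fintype finset.
Import Order.TTheory GRing.Theory Num.Theory.
Import numFieldNormedType.Exports.

Set Implicit Arguments.
Unset Strict Implicit.
Unset Printing Implicit Defensive.

(** * Connected vertex sets and K33 minors *)

Section Connectivity.
Variables (V : finType) (G : rel V).
Hypothesis Gsym : symmetric G.

Definition induced (S : {set V}) : rel V :=
  fun x y => [&& x \in S, y \in S & G x y].

Definition conn (S : {set V}) : Prop :=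
  {in S &, forall x y, connect (induced S) x y}.

Definition touch (A B : {set V}) : Prop :=
  exists x y : V, [/\ x \in A, y \in B & G x y].

Definition nb (X : {set V}) : {set V} :=
  [set y | (y \notin X) && [exists x in X, G x y]].

Definition comp (S : {set V}) (x : V) : {set V} :=
  [set y in S | connect (induced S) x y].

Definition K33_minor (A B : 'I_3 -> {set V}) : Prop :=
  [/\ forall i, conn (A i) /\ conn (B i),
      forall i j, i != j -> [disjoint A i & A j] /\ [disjoint B i & B j],
      forall i j, [disjoint A i & B j] &
      forall i j, touch (A i) (B j)].

Lemma induced_sym S : symmetric (induced S).
Proof. by move=> x y; rewrite /induced Gsym andbCA. Qed.

Lemma induced_connect_sym S : connect_sym (induced S).
Proof. exact: (sym_connect_sym (induced_sym S)). Qed.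

Lemma connect_exit (e : rel V) (P : pred V) x y :
  connect e x y -> P x -> ~~ P y -> exists u v, [/\ P u, ~~ P v & e u v].
Proof.
move=> /connectP [p]; elim: p x => [|z p IH] x /=.
  by move=> _ -> Px /negP.
move=> /andP[exz pz] yE Px Py; case Pz: (P z); first exact: (IH z).
by exists x, z; rewrite Px Pz.
Qed.

Lemma induced_sub (S S' : {set V}) x y : S \subset S' ->
  connect (induced S) x y -> connect (induced S') x y.
Proof.
move=> /subsetP sSS'; apply: connect_sub => u v /and3P[uS vS uv].
by apply: connect1; rewrite /induced !sSS'.
Qed.

Lemma conn_from (S : {set V}) x0 :
  (forall x, x \in S -> connect (induced S) x x0) -> conn S.
Proof.
move=> Sx0 x y xS yS; apply: (connect_trans (Sx0 _ xS)).
by rewrite induced_connect_sym Sx0.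
Qed.

Lemma touchS (A A1 B B1 : {set V}) : A \subset A1 -> B \subset B1 -> touch A B -> touch A1 B1.
Proof.
by move=> /subsetP sA /subsetP sB [x [y [/sA xA /sB yB xy]]]; exists x, y.
Qed.

Lemma connU A B : conn A -> conn B -> touch A B -> conn (A :|: B).
Proof.
move=> cA cB [a [b [aA bB ab]]]; apply: (@conn_from _ a) => x.
rewrite inE => /orP[xA|xB]; first exact: induced_sub (subsetUl _ _) (cA _ _ xA aA).
apply: connect_trans (induced_sub (subsetUr _ _) (cB _ _ xB bB)) _.
by apply: connect1; rewrite /induced !inE aA bB orbT Gsym ab.
Qed.

Lemma mem_nb (X : {set V}) x y : x \in X -> G x y -> y \notin X -> y \in nb X.
Proof.
by move=> xX xy yX; rewrite inE yX; apply/existsP; exists x; rewrite xX.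
Qed.

Lemma nbP (X : {set V}) y : y \in nb X -> y \notin X /\ exists2 x, x \in X & G x y.
Proof.
rewrite inE => /andP[yX /existsP[x /andP[xX xy]]]; split=> //.
by exists x.
Qed.

Lemma comp_sub S x : comp S x \subset S.
Proof. by apply/subsetP => y; rewrite inE => /andP[]. Qed.

Lemma comp_refl (S : {set V}) x : x \in S -> x \in comp S x.
Proof. by move=> xS; rewrite inE xS connect0. Qed.

Lemma comp_closed (S : {set V}) x y z : y \in comp S x -> z \in S -> G y z -> z \in comp S x.
Proof.
rewrite !inE => /andP[yS xy] zS yz; rewrite zS /=.
by apply: connect_trans xy (connect1 _); rewrite /induced yS zS.
Qed.

Lemma comp_eq S x y : y \in comp S x -> comp S y = comp S x.
Proof.
rewrite inE => /andP[yS xy]; apply/setP => z; rewrite !inE.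
by rewrite (same_connect (@induced_connect_sym S) xy).
Qed.

(** Every prefix of a path in [S] that starts in the component also ends in it, so the path never
    leaves the component. *)
Lemma conn_comp S x : conn (comp S x).
Proof.
move=> y z yC; rewrite -(comp_eq yC) in_set => /andP[_ /connectP[p]].
elim/last_ind: p z => [|p t IH] z /=; first by move=> _ ->; exact: connect0.
rewrite rcons_path last_rcons => /andP[pp e1] ->{z}.
have yS : y \in S by move: yC; rewrite inE => /andP[].
have cl := IH _ pp erefl; apply: connect_trans cl (connect1 _).
have : last y p \in comp S y.
  rewrite inE; case/and3P: e1 => -> _ _ /=; apply/connectP; by exists p.
move=> lC; have tS : t \in S by case/and3P: e1.
have ltG : G (last y p) t by case/and3P: e1.
by rewrite /induced lC ltG (comp_closed lC tS ltG).
Qed.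

Lemma nb_comp (X M : {set V}) x : M \subset X -> nb (comp (X :\: M) x) \subset nb X :|: M.
Proof.
move=> /subsetP MX; apply/subsetP => y /nbP[yC [z zC zy]]; rewrite in_setU.
case: (boolP (y \in M)) => yM; first by rewrite orbT.
have zX : z \in X by have := subsetP (comp_sub _ _) _ zC; rewrite inE => /andP[].
rewrite orbF (mem_nb zX zy) //; apply: contra yC => yX.
by apply: comp_closed zC _ zy; rewrite inE yM yX.
Qed.

(** On a path in [X] from [x] to [M], the edge that leaves the component can only enter [M], since
    components of [X :\: M] are maximal. *)
Lemma touch_comp (X M : {set V}) x : conn X -> M \subset X -> M != set0 ->
  x \in X :\: M -> touch M (comp (X :\: M) x).
Proof.
move=> cX MX /set0Pn[m mM] xXM.
have xX : x \in X by move: xXM; rewrite inE => /andP[].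
have mX := subsetP MX _ mM.
have mC : m \notin comp (X :\: M) x by rewrite !inE mM.
have [u [v [uC vC /and3P[uX vX uv]]]] :=
  connect_exit (cX _ _ xX mX) (comp_refl xXM) mC.
exists v, u; split=> //; last by rewrite Gsym.
apply: contraR vC => vM; apply: comp_closed uC _ uv.
by rewrite inE vM vX.
Qed.

End Connectivity.

(** * Vertical paths in a rooted tree *)

Record rooted_tree (V : finType) (G : rel V) (par : V -> V) (r : V) (lay : V -> nat) : Prop :=
 RootedTree {
  par_root : par r = r;
  par_edge : forall x, x != r -> G x (par x);
  lay_par : forall x, x != r -> lay (par x) < lay x }.

Section Tree.
Variables (V : finType) (G : rel V).
Hypothesis Gsym : symmetric G.
Variables (par : V -> V) (r : V) (lay : V -> nat).
Hypothesis T : rooted_tree G par r lay.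

(** The vertical path from [x] to the root, both included: the orbit of [x] under [par] stops at the
    fixed point [r]. *)
Definition anc (x : V) : {set V} := [set y | fconnect par x y].

Definition upclosed (U : {set V}) : Prop := forall x, x \in U -> par x \in U.

Lemma anc_refl x : x \in anc x.
Proof. by rewrite inE connect0. Qed.

Lemma anc_par x : par x \in anc x.
Proof. by rewrite inE fconnect1. Qed.

Lemma anc_trans y x z : y \in anc x -> z \in anc y -> z \in anc x.
Proof. by rewrite !inE; exact: connect_trans. Qed.

Lemma anc_upclosed x : upclosed (anc x).
Proof. by move=> y yx; apply: anc_trans yx (anc_par y). Qed.

Lemma upclosedU A B : upclosed A -> upclosed B -> upclosed (A :|: B).
Proof. by move=> uA uB x; rewrite !inE => /orP[/uA|/uB] ->; rewrite ?orbT. Qed.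

Lemma upclosedI A B : upclosed A -> upclosed B -> upclosed (A :&: B).
Proof. by move=> uA uB x; rewrite !inE => /andP[/uA -> /uB]. Qed.

Lemma upclosed0 : upclosed set0.
Proof. by move=> x; rewrite inE. Qed.

Lemma upclosed_anc U x y : upclosed U -> x \in U -> y \in anc x -> y \in U.
Proof.
move=> uU xU; rewrite inE => /iter_findex <-.
by elim: (findex _ _ _) => //= n /uU.
Qed.

Lemma ancE x y : y \in anc x -> y = x \/ y \in anc (par x).
Proof.
rewrite inE => /iter_findex <-; case: (findex _ _ _) => [|n]; first by left.
by right; rewrite iterSr inE fconnect_iter.
Qed.

Lemma anc_total x y z : y \in anc x -> z \in anc x -> y \in anc z \/ z \in anc y.
Proof.
rewrite !inE => /iter_findex <- /iter_findex <-.
move: (findex _ x y) (findex _ x z) => m n.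
have [le_mn|/ltnW le_nm] := leqP m n.
  by right; rewrite -(subnK le_mn) iterD fconnect_iter.
by left; rewrite -(subnK le_nm) iterD fconnect_iter.
Qed.

Lemma lay_par_le x : lay (par x) <= lay x.
Proof.
by have [->|xr] := eqVneq x r; [rewrite (par_root T)|exact: ltnW (lay_par T xr)].
Qed.

Lemma anc_lay x y : y \in anc x -> y != x -> lay y < lay x.
Proof.
rewrite inE => /iter_findex <-; elim: (findex _ _ _) => [|n IH]; first by rewrite eqxx.
rewrite iterS; have [E|NE] := eqVneq (iter n par x) x; last first.
  by move=> _; apply: leq_ltn_trans (lay_par_le _) (IH NE).
rewrite E; have [->|xr] := eqVneq x r; first by rewrite (par_root T) eqxx.
by move=> _; exact: lay_par T _ xr.
Qed.

Lemma anc_anti x y : y \in anc x -> x \in anc y -> x = y.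
Proof.
move=> yx xy; apply/eqP; apply/negPn/negP => NE.
have l1 := anc_lay xy NE; rewrite eq_sym in NE.
by have := ltn_trans l1 (anc_lay yx NE); rewrite ltnn.
Qed.

(** This is what makes separators small in each layer: two vertices of a vertical path are
    comparable, and [lay] drops strictly towards a proper ancestor. *)
Lemma anc_lay_inj x : {in anc x &, injective lay}.
Proof.
have aux y z : y \in anc z -> lay y = lay z -> y = z.
  move=> yz E; apply/eqP; apply/negPn/negP => /(anc_lay yz).
  by rewrite E ltnn.
move=> y z yx zx E; have [yz|zy] := anc_total yx zx; first exact: aux.
by apply/esym/aux.
Qed.

Lemma anc_root x : r \in anc x.
Proof.
have [n] := ubnP (lay x); elim: n x => // n IH x /ltnSE le_xn.
have [->|xr] := eqVneq x r; first exact: anc_refl.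
apply: anc_trans (anc_par x) (IH _ _); exact: leq_trans (lay_par T xr) le_xn.
Qed.

Lemma anc_parF x : x != r -> x \notin anc (par x).
Proof.
move=> xr; apply/negP => xp; have := lay_par T xr.
by rewrite -(anc_anti (anc_par x) xp) ltnn.
Qed.

(* The first vertex outside [P] on the way from [x] up to [y] is [par z]. *)
Lemma anc_exit (P : pred V) x y : P x -> y \in anc x -> ~~ P y ->
  exists z, [/\ z \in anc x, P z /\ ~~ P (par z), y \in anc (par z), G z (par z) &
    forall t, t \in anc x -> z \in anc t -> P t].
Proof.
have [n] := ubnP (lay x); elim: n x => // n IH x /ltnSE le_xn Px yx Py.
have xr : x != r.
  apply: contraNneq Py => xr; move: yx; rewrite xr => yr.
  by rewrite (anc_anti yr (anc_root y)) in xr; rewrite -xr.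
have yp : y \in anc (par x) by case: (ancE yx) => // E; rewrite E Px in Py.
case Pp: (P (par x)).
  have [z [zx Pz yz Gz zP]] := IH _ (leq_trans (lay_par T xr) le_xn) Pp yp Py.
  exists z; split=> //; first exact: anc_trans (anc_par x) zx.
  by move=> t /ancE[->|tp] // zt; apply: zP.
exists x; split=> //; rewrite ?anc_refl ?Px ?Pp ?(par_edge T xr) //.
by move=> t tx xt; rewrite (anc_anti xt tx).
Qed.

Lemma climb (S : {set V}) x y : y \in anc x ->
  (forall z, z \in anc x -> y \in anc z -> z \in S) -> connect (induced G S) x y.
Proof.
have [n] := ubnP (lay x); elim: n x => // n IH x /ltnSE le_xn yx zS.
have [->|NE] := eqVneq y x; first exact: connect0.
have yp : y \in anc (par x) by case: (ancE yx) => // E; rewrite E eqxx in NE.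
have xr : x != r.
  apply: contraNneq NE => xr; rewrite xr in yx *.
  by apply/eqP; rewrite (anc_anti yx (anc_root y)).
apply: (@connect_trans _ _ (par x)).
  apply: connect1; rewrite /induced (par_edge T xr) andbT.
  by rewrite !zS ?anc_refl ?anc_par.
apply: IH yp _; first exact: leq_trans (lay_par T xr) le_xn.
by move=> z zp; apply: zS; apply: anc_trans (anc_par x) zp.
Qed.

(** Every vertex of the set is comparable with [e] on one of the two paths. The tree path between
    them stays in [W] and avoids [U], as both are up-closed. *)
Lemma conn_hull (a b e : V) (U W : {set V}) : upclosed U -> upclosed W ->
  e \in anc a -> e \in anc b -> e \in W -> e \notin U ->
  conn G ((anc a :|: anc b) :&: W :\: U).
Proof.
move=> uU uW ea eb eW eU; apply: (@conn_from _ _ Gsym _ e) => x.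
rewrite 2!inE => /and3P[xU xab xW].
have [c [xc ec sub]] : exists c, [/\ x \in anc c, e \in anc c & anc c \subset anc a :|: anc b].
  by case/setUP: xab => xab; [exists a|exists b]; split=> //; rewrite ?subsetUl ?subsetUr.
have up u v : u \in anc c -> v \in anc u -> u \in W -> v \notin U ->
   connect (induced G ((anc a :|: anc b) :&: W :\: U)) u v.
  move=> uc vu uW' vU; apply: climb vu _ => z zu vz.
  rewrite 2!inE; apply/and3P; split; last exact: upclosed_anc zu.
  - by apply: contra vU => zU; apply: upclosed_anc zU vz.
  - by apply: (subsetP sub); apply: anc_trans zu.
have [xe|ex] := anc_total xc ec; last exact: up.
rewrite (induced_connect_sym Gsym); exact: up.
Qed.

End Tree.

(** * Quadrilateral regions *)

Definition inS := (in_setU, in_setI, in_setD, in_set1, in_set0).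

(** Set relations are checked pointwise by splitting on every membership. Known facts enter as
    boolean implications, hence the uses of [introT implyP] below. *)
Ltac set_cases :=
  rewrite ?inS;
  repeat match goal with |- context [?x \in ?A] => case: (x \in A); rewrite //= end.

Section States.
Variables (V : finType) (G : rel V).
Hypothesis Gsym : symmetric G.
Variables (par : V -> V) (r : V) (lay : V -> nat).
Hypothesis T : rooted_tree G par r lay.

Local Notation anc := (anc par).
Local Notation upclosed := (upclosed par).
Local Notation conn := (conn G).
Local Notation touch := (touch G).
Local Notation nb := (nb G).
Local Notation comp := (comp G).

Definition hull (a b : V) : {set V} := anc a :|: anc b.

Lemma hullC a b : hull a b = hull b a.
Proof. exact: setUC. Qed.

Lemma hull_upclosed a b : upclosed (hull a b).
Proof. by apply: upclosedU; exact: anc_upclosed. Qed.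

(* An edge from [a] to [q], or a connected set [O] standing for the inner
   vertices of a path from [a] to [q]. *)
Definition link (a q : V) (O : {set V}) : Prop :=
  (G a q /\ O = set0) \/
  [/\ conn O, exists2 y1, y1 \in O & G a y1 & exists2 y1, y1 \in O & G q y1].

Lemma link_sym a q O : link a q O -> link q a O.
Proof. by case=> [[aq ->]|[cO aO qy2O]]; [left; rewrite Gsym|right]. Qed.

Lemma conn_vertical a W : upclosed W -> conn (anc a :\: W).
Proof.
move=> uW; apply: (@conn_from _ _ Gsym _ a) => x; rewrite inS => /andP[xW xa].
rewrite (induced_connect_sym Gsym); apply: (climb T xa) => z za xz.
by rewrite inS za andbT; apply: contra xW => zW; apply: (upclosed_anc uW zW xz).
Qed.

Lemma bottom_vertical a x W : upclosed W -> x \in anc a :\: W -> a \in anc a :\: W.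
Proof.
move=> uW; rewrite !inS anc_refl andbT => /andP[xW xa].
by apply: contra xW => aW; apply: upclosed_anc uW aW xa.
Qed.

(** One end of the boundary of a region: the lower pieces of the paths from [a] and [q], joined at
    the bottom by the link through [O]. *)
Definition side a q (Wa Wq O : {set V}) := (anc a :\: Wa) :|: (anc q :\: Wq) :|: O.

Lemma sideC a q Wa Wq O : side q a Wq Wa O = side a q Wa Wq O.
Proof. by rewrite /side [X in X :|: O]setUC. Qed.

Lemma side_conn a q (Wa Wq O : {set V}) : upclosed Wa -> upclosed Wq -> link a q O ->
  (anc a :\: Wa) :|: (anc q :\: Wq) != set0 -> conn (side a q Wa Wq O).
Proof.
move=> uWa uWq; rewrite /side.
(* One of the two pieces may be empty; a nonempty one contains its bottom vertex, and by symmetry it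
   is the piece of [a]. *)
wlog: a q Wa Wq uWa uWq / a \in anc a :\: Wa => [WL lk ne|].
  have /set0Pn[x] := ne; rewrite in_setU => /orP[xa|xq].
    by apply: (WL a q) => //; exact: bottom_vertical xa.
  have := WL q a Wq Wa uWq uWa (bottom_vertical uWq xq) (link_sym lk).
  by rewrite [X in X :|: O]setUC; apply; rewrite setUC.
move=> aL lk _; have cL : conn (anc a :\: Wa) by exact: conn_vertical.
have cq : conn (anc q :\: Wq) by exact: conn_vertical.
case: lk => [[aq ->]|[cO [y1 y1O ay1] [y2 y2O qy2]]].
  rewrite setU0; have [->|/set0Pn[x xq]] := eqVneq (anc q :\: Wq) set0.
    by rewrite setU0.
  apply: (connU Gsym) => //; exists a, q; split=> //; exact: bottom_vertical xq.
have cLO : conn ((anc a :\: Wa) :|: O).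
  by apply: (connU Gsym) => //; exists a, y1.
have [->|/set0Pn[x xq]] := eqVneq (anc q :\: Wq) set0; first by rewrite setU0.
rewrite setUAC; apply: (connU Gsym) => //; exists y2, q; split=> //.
- by rewrite in_setU y2O orbT.
- exact: bottom_vertical xq.
- by rewrite Gsym.
Qed.

(** If [a] is in [Wa], then [c] is [a] and the link supplies the edge; otherwise the edge is the one
    by which the path from [a] enters [Wa]. *)
Lemma side_touch a q (Wa Wq O : {set V}) e : upclosed Wa -> upclosed Wq ->
  link a q O -> (anc a :\: Wa) :|: (anc q :\: Wq) != set0 ->
  e \in anc a -> e \in Wa ->
  exists x c, [/\ x \in side a q Wa Wq O, G x c, c \in anc a, c \in Wa & e \in anc c].
Proof.
move=> uWa uWq lk ne ea eW.
have [aW|aW] := boolP (a \in Wa).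
  have qL : q \in anc q :\: Wq.
    have /set0Pn[x] := ne; rewrite in_setU => /orP[|/(bottom_vertical uWq)] //.
    by move=> /(bottom_vertical uWa); rewrite inS aW.
  case: lk => [[aq ->]|[cO [y1 y1O ay1] _]].
    by exists q, a; rewrite Gsym !in_setU qL orbT anc_refl.
  by exists y1, a; rewrite Gsym !in_setU y1O !orbT anc_refl.
have := anc_exit T (P := [pred x | x \notin Wa]) aW ea.
rewrite /= eW => /(_ isT) [z [za [zW]]]; rewrite negbK => pW ep Gz _.
exists z, (par z); split=> //; last exact: anc_upclosed.
by rewrite !in_setU in_setD zW za.
Qed.

(* [X] is bounded by the subtrees [A = hull a b :\: U] and
   [B = hull q1 q2 :\: (U :|: hull a b)]; [link1] and [link2] close the boundary
   through outside vertices [O1] and [O2].  Removing the up-closed set [U] allows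
   [A] to stop below the root. *)
Record quad_region (U : {set V}) a b q1 q2 (O1 O2 X : {set V}) : Prop := QuadRegion {
  quad_up : upclosed U;
  quad_e : exists e, [/\ e \in anc a, e \in anc b & e \notin U];
  quad_d : exists d, [/\ d \in anc q1, d \in anc q2 & d \notin U :|: hull a b];
  quad_conn : conn X;
  quad_disj : forall x, x \in X -> x \notin U :|: hull a b :|: hull q1 q2;
  quad_nb : nb X \subset (hull a b :|: hull q1 q2) :\: U;
  quad_link1 : link a q1 O1;
  quad_link2 : link b q2 O2;
  quad_O12 : forall x, x \in O1 -> x \notin O2;
  quad_O1 : forall x, x \in O1 -> x \notin X :|: ((hull a b :|: hull q1 q2) :\: U);
  quad_O2 : forall x, x \in O2 -> x \notin X :|: ((hull a b :|: hull q1 q2) :\: U) }.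

Lemma quad_sym U a b q1 q2 O1 O2 X : quad_region U a b q1 q2 O1 O2 X -> quad_region U b a q2 q1 O2 O1 X.
Proof.
case=> uU [e [ea eb eU]] [d [dq1 dq2 dU]] cX dX nX l1 l2 O12 dO1 dO2.
split; rewrite ?(hullC b a) ?(hullC q2 q1) //; first by exists e.
- by exists d.
- by move=> x xO2; apply/negP => /O12; rewrite xO2.
Qed.

(* The vertical path from [w] stays in [X] until it enters [S]. *)
Definition exits (X S : {set V}) (w : V) : Prop :=
  exists y, [/\ y \in anc w, y \in S & forall t, t \in anc w -> y \in anc t -> t \in X \/ t = y].

Hypothesis noK33 : forall A B, ~ K33_minor G A B.

Section Chord.
Variables (U : {set V}) (a b q1 q2 : V) (O1 O2 X : {set V}) (w w' : V).
Hypothesis Q : quad_region U a b q1 q2 O1 O2 X.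
Let A := hull a b :\: U.
Let B := hull q1 q2 :\: (U :|: hull a b).
Hypothesis ww' : G w w'.
Hypothesis exA : exits X A w.
Hypothesis exB : exits X B w'.
Hypothesis inX : w \in X \/ w' \in X.
Let M := X :&: hull w w'.

Lemma exits_sub (S S' : {set V}) v : S \subset S' -> upclosed S' -> exits X S v ->
  anc v \subset X :|: S'.
Proof.
move=> /subsetP sS uS' [y [yv yS yt]]; apply/subsetP => t tv; rewrite in_setU.
have [yt'|ty] := anc_total yv tv.
  by case: (yt _ tv yt') => [->|->] //; rewrite sS ?orbT.
by rewrite (upclosed_anc uS' (sS _ yS) ty) orbT.
Qed.

(** Up to its exit the path from [v] is in [X], and from there on in [S']; so its part in [X] has
    the form required by [conn_vertical]. *)
Lemma exits_vertical (S S' : {set V}) v : S \subset S' -> upclosed S' -> exits X S v ->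
  (forall x, x \in X -> x \notin S') -> X :&: anc v = anc v :\: S'.
Proof.
move=> sS uS' ev dX; apply/setP => x; have := subsetP (exits_sub sS uS' ev) x.
move: (dX x); rewrite !inS.
by case: (x \in X); case: (x \in anc v); case: (x \in S') => //= h1 h2;
  [have := h1 isT|have := h2 isT].
Qed.

(** If [v] is in [X], the last vertex of its path before leaving [X] is adjacent to the exit.
    Otherwise [v] is itself the exit and the edge to [v'] does it. *)
Lemma exits_touch (S : {set V}) v v' : exits X S v -> G v v' ->
  (forall x, x \in S -> x \notin X) ->
  v \in X \/ v' \in X -> touch (X :&: hull v v') (anc v :&: S).
Proof.
move=> [y [yv yS yt]] vv' dS inX'.
have [vX|vX] := boolP (v \in X).
  have [z [zv [zX pX] yp Gz _]] := anc_exit T (P := fun x => x \in X) vX yv (dS _ yS).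
  have pv : par z \in anc v by exact: anc_upclosed.
  exists z, (par z); rewrite !inS zv zX; split=> //=.
  by case: (yt _ pv yp) => [pX'|->]; [rewrite pX' in pX|rewrite yv yS].
have v'X : v' \in X by case: inX' => // vX'; rewrite vX' in vX.
have E : v = y by case: (yt _ (anc_refl par v) yv) => // vX'; rewrite vX' in vX.
by exists v', v; rewrite Gsym !inS v'X !anc_refl orbT; split=> //; rewrite E.
Qed.

Lemma dAX x : x \in X -> x \notin hull a b.
Proof. by move=> /(quad_disj Q); set_cases. Qed.

Lemma dBX x : x \in X -> x \notin hull q1 q2.
Proof. by move=> /(quad_disj Q); set_cases. Qed.

Lemma ancw_sub : anc w \subset X :|: hull a b.
Proof. by apply: exits_sub exA; rewrite ?subsetDl //; exact: hull_upclosed. Qed.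

Lemma ancw'_sub : anc w' \subset X :|: hull q1 q2.
Proof. by apply: exits_sub exB; rewrite ?subsetDl //; exact: hull_upclosed. Qed.

Lemma chord_neq0 : M != set0.
Proof.
by apply/set0Pn; case: inX => h; [exists w|exists w']; rewrite !inS h anc_refl ?orbT.
Qed.

Lemma chord_conn : conn M.
Proof.
rewrite /M setIUr.
have EA := exits_vertical (subsetDl _ _) (@hull_upclosed a b) exA dAX.
have EB := exits_vertical (subsetDl _ _) (@hull_upclosed q1 q2) exB dBX.
have cA : conn (X :&: anc w) by rewrite EA; apply: conn_vertical; exact: hull_upclosed.
have cB : conn (X :&: anc w') by rewrite EB; apply: conn_vertical; exact: hull_upclosed.
have [->|/set0Pn[x]] := eqVneq (X :&: anc w) set0; first by rewrite set0U.
have [->|/set0Pn[x']] := eqVneq (X :&: anc w') set0; first by rewrite setU0.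
rewrite EA EB => /(bottom_vertical (@hull_upclosed _ _)) wB.
move=> /(bottom_vertical (@hull_upclosed _ _)) wA.
by rewrite -EA -EB; apply: (connU Gsym) => //; exists w, w'; rewrite EA EB.
Qed.

(** The chord cuts [X] into regions bounded by [hull a w :|: hull q1 w'] and
    [hull b w :|: hull q2 w']. [L] and [R] are the ends of the old boundary that belong to only one
    of them, and [Y] is what the two have in common. *)
Let L := side a q1 (U :|: (hull b w :|: hull q2 w')) (U :|: hull a b :|: (hull b w :|: hull q2 w')) O1.
Let R := side b q2 (U :|: (hull a w :|: hull q1 w')) (U :|: hull a b :|: (hull a w :|: hull q1 w')) O2.
Let Y := (hull a w :|: hull q1 w') :&: (hull b w :|: hull q2 w').


Let uAB : upclosed (hull a b) := @hull_upclosed a b.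
Let uU : upclosed U := quad_up Q.
Let uW1 : upclosed (hull a w :|: hull q1 w').
Proof. by apply: upclosedU; exact: hull_upclosed. Qed.
Let uW2 : upclosed (hull b w :|: hull q2 w').
Proof. by apply: upclosedU; exact: hull_upclosed. Qed.
Let uY : upclosed Y.
Proof. exact: upclosedI. Qed.

(** The chord lies in [hull w w'] and outside [U], so [s] is not on it. Thus [s] is on the old
    boundary, but off the paths from [a] and [q1]. *)
Lemma chord_nb_side (C : {set V}) s : nb C \subset nb X :|: M -> s \in nb C ->
  s \notin (hull a w :|: hull q1 w') :\: U ->
  s \in (anc b :\: (U :|: (hull a w :|: hull q1 w'))) :|:
        (anc q2 :\: (U :|: hull a b :|: (hull a w :|: hull q1 w'))).
Proof.
move=> /subsetP sC sN; have := sC _ sN; rewrite in_setU => /orP[/(subsetP (quad_nb Q))|].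
  by rewrite /hull; set_cases.
by rewrite in_setI => /andP[/(quad_disj Q)]; rewrite /hull; set_cases.
Qed.

(* The branch sets are the two sides [L] and [R] of the boundary and the chord [M]
   against the middle parts [C0] of [A] and [D0] of [B] and the component [C]. *)
Lemma chord_K33 (C : {set V}) s t : conn C -> C \subset X :\: M -> touch M C ->
  nb C \subset nb X :|: M -> s \in nb C -> t \in nb C ->
  s \in (anc b :\: (U :|: (hull a w :|: hull q1 w'))) :|:
        (anc q2 :\: (U :|: hull a b :|: (hull a w :|: hull q1 w'))) ->
  t \in (anc a :\: (U :|: (hull b w :|: hull q2 w'))) :|:
        (anc q1 :\: (U :|: hull a b :|: (hull b w :|: hull q2 w'))) ->
  False.
Proof.
move=> cC sCX tMC sN /nbP[sC [cs csC Gs]] /nbP[tC [ct ctC Gt]] sR tL.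
have [e [ea eb eU]] := quad_e Q.
have [d [dq1 dq2 dU]] := quad_d Q.
(* The common ancestors [e] and [d] lie in [Y]; they hold the middle parts of [A] and [B]
   together. *)
have eW1 : e \in hull a w :|: hull q1 w' by rewrite !in_setU ea.
have eW2 : e \in hull b w :|: hull q2 w' by rewrite !in_setU eb.
have dW1 : d \in hull a w :|: hull q1 w' by rewrite !in_setU dq1 !orbT.
have dW2 : d \in hull b w :|: hull q2 w' by rewrite !in_setU dq2 !orbT.
have uUA := upclosedU uU uAB.
have uU1 := upclosedU uU uW1.
have uU2 := upclosedU uU uW2.
have uA1 := upclosedU uUA uW1.
have uA2 := upclosedU uUA uW2.
have Lne : anc a :\: (U :|: (hull b w :|: hull q2 w')) :|:
  anc q1 :\: (U :|: hull a b :|: (hull b w :|: hull q2 w')) != set0.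
  by apply/set0Pn; exists t.
have Rne : anc b :\: (U :|: (hull a w :|: hull q1 w')) :|:
  anc q2 :\: (U :|: hull a b :|: (hull a w :|: hull q1 w')) != set0.
  by apply/set0Pn; exists s.
have l1 := quad_link1 Q; have l2 := quad_link2 Q.
set C0 := hull a b :&: Y :\: U.
set D0 := hull q1 q2 :&: Y :\: (U :|: hull a b).
have cC0 : conn C0.
  by apply: (conn_hull Gsym T uU uY ea eb _ eU); rewrite in_setI eW1.
have cD0 : conn D0.
  by apply: (conn_hull Gsym T uUA uY dq1 dq2 _ dU); rewrite in_setI dW1.
have LC0 : touch L C0.
  have [|x [c [xL Gxc ca cW ec]]] := side_touch uU2 uA2 l1 Lne ea.
    by rewrite in_setU eW2 orbT.
  have cU : c \notin U by apply: contra eU => cU; apply: upclosed_anc cU ec.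
  by exists x, c; split=> //; move: ca cW cU; rewrite /C0 /Y /hull; set_cases.
have LD0 : touch L D0.
  rewrite setUC in Lne.
  have [|x [c [xL Gxc ca cW ec]]] := side_touch uA2 uU2 (link_sym l1) Lne dq1.
    by rewrite in_setU dW2 orbT.
  have cU : c \notin U :|: hull a b by apply: contra dU => cU; apply: upclosed_anc cU ec.
  rewrite sideC in xL; exists x, c; split=> //.
  by move: ca cW cU; rewrite /D0 /Y /hull; set_cases.
have RC0 : touch R C0.
  have [|x [c [xL Gxc ca cW ec]]] := side_touch uU1 uA1 l2 Rne eb.
    by rewrite in_setU eW1 orbT.
  have cU : c \notin U by apply: contra eU => cU; apply: upclosed_anc cU ec.
  by exists x, c; split=> //; move: ca cW cU; rewrite /C0 /Y /hull; set_cases.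
have RD0 : touch R D0.
  rewrite setUC in Rne.
  have [|x [c [xL Gxc ca cW ec]]] := side_touch uA1 uU1 (link_sym l2) Rne dq2.
    by rewrite in_setU dW1 orbT.
  have cU : c \notin U :|: hull a b by apply: contra dU => cU; apply: upclosed_anc cU ec.
  rewrite sideC in xL; exists x, c; split=> //.
  by move: ca cW cU; rewrite /D0 /Y /hull; set_cases.
(* The chord meets [A] at an ancestor of [w], which lies in both hulls and hence in [Y]. *)
have MC0 : touch M C0.
  apply: touchS (exits_touch exA ww' _ inX); rewrite ?subxx //.
    by apply/subsetP => x; rewrite /A /C0 /Y /hull; set_cases.
  by move=> x xA; apply/negP => /dAX; move: xA; rewrite /A /hull; set_cases.
have MD0 : touch M D0.
  have w'w : G w' w by rewrite Gsym.
  have dB x : x \in B -> x \notin X.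
    by move=> xA; apply/negP => /dBX; move: xA; rewrite /B /hull; set_cases.
  have inX' : w' \in X \/ w \in X by case: inX => h; [right|left].
  apply: touchS (exits_touch exB w'w dB inX'); first by rewrite hullC.
  by apply/subsetP => x; rewrite /B /D0 /Y /hull; set_cases.
have LC : touch L C by exists t, ct; rewrite Gsym in_setU tL.
have RC : touch R C by exists s, cs; rewrite Gsym in_setU sR.
have cL : conn L by apply: side_conn => //; rewrite setUC.
have cR : conn R by apply: side_conn => //; rewrite setUC.
have dis (S1 S2 : {set V}) : (forall x, x \in S1 -> x \notin S2) -> [disjoint S1 & S2].
  by move=> h; apply/pred0P => x /=; apply/negP => /andP[/h/negP].
have CX x : x \in C -> x \in X :\: M by exact: (subsetP sCX).
have dX x := introT implyP (@quad_disj _ _ _ _ _ _ _ _ Q x).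
have dO12 x := introT implyP (@quad_O12 _ _ _ _ _ _ _ _ Q x).
have dO1 x := introT implyP (@quad_O1 _ _ _ _ _ _ _ _ Q x).
have dO2 x := introT implyP (@quad_O2 _ _ _ _ _ _ _ _ Q x).
have LR : [disjoint L & R].
  apply: dis => x; move: (dO1 x) (dO2 x) (dO12 x); rewrite /L /R /side /hull.
  by set_cases.
have LM : [disjoint L & M].
  apply: dis => x; move: (dO1 x) (dX x); rewrite /L /M /side /hull.
  by set_cases.
have RM : [disjoint R & M].
  apply: dis => x; move: (dO2 x) (dX x); rewrite /R /M /side /hull.
  by set_cases.
have CD0 : [disjoint C0 & D0].
  by apply: dis => x; rewrite /C0 /D0 /Y /hull; set_cases.
have C0C : [disjoint C0 & C].
  apply: dis => x /= xC0; apply/negP => /CX; move: xC0 (dX x).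
  by rewrite /C0 /Y /hull; set_cases.
have D0C : [disjoint D0 & C].
  apply: dis => x /= xC0; apply/negP => /CX; move: xC0 (dX x).
  by rewrite /D0 /Y /hull; set_cases.
have LC0d : [disjoint L & C0].
  by apply: dis => x; move: (dO1 x); rewrite /L /C0 /Y /side /hull; set_cases.
have LD0d : [disjoint L & D0].
  by apply: dis => x; move: (dO1 x); rewrite /L /D0 /Y /side /hull; set_cases.
have RC0d : [disjoint R & C0].
  by apply: dis => x; move: (dO2 x); rewrite /R /C0 /Y /side /hull; set_cases.
have RD0d : [disjoint R & D0].
  by apply: dis => x; move: (dO2 x); rewrite /R /D0 /Y /side /hull; set_cases.
have MC0d : [disjoint M & C0].
  by apply: dis => x; move: (dX x); rewrite /M /C0 /Y /side /hull; set_cases.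
have MD0d : [disjoint M & D0].
  by apply: dis => x; move: (dX x); rewrite /M /D0 /Y /side /hull; set_cases.
have MCd : [disjoint M & C].
  apply: dis => x xM; apply/negP => /CX; move: xM.
  by rewrite /M; set_cases.
have LCd : [disjoint L & C].
  apply: dis => x xL; apply/negP => /CX; move: xL (dX x) (dO1 x).
  by rewrite /L /side /hull; set_cases.
have RCd : [disjoint R & C].
  apply: dis => x xL; apply/negP => /CX; move: xL (dX x) (dO2 x).
  by rewrite /R /side /hull; set_cases.
apply: (noK33 (A := fun i => nth set0 [:: L; R; M] i)
              (B := fun i => nth set0 [:: C0; D0; C] i)); split.
- by move=> [[|[|[|]]] ?] //=; split=> //; exact: chord_conn.
- move=> i j; case: i => [[|[|[|]]] ?] //; case: j => [[|[|[|]]] ?] //= _;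
    by split=> //; rewrite disjoint_sym.
- by move=> i j; case: i => [[|[|[|]]] ?] //; case: j => [[|[|[|]]] ?].
- by move=> i j; case: i => [[|[|[|]]] ?] //; case: j => [[|[|[|]]] ?].
Qed.

(** The edge from [w] to [w'] takes over the role of the link between [b] and [q2]. *)
Lemma chord_quad (C : {set V}) : conn C -> C \subset X :\: M ->
  nb C \subset (hull a w :|: hull q1 w') :\: U -> quad_region U a w q1 w' O1 set0 C.
Proof.
move=> cC /subsetP CX sN.
have [e [ea eb eU]] := quad_e Q.
have [d [dq1 dq2 dU]] := quad_d Q.
have dX x := introT implyP (@quad_disj _ _ _ _ _ _ _ _ Q x).
have sw x := introT implyP (subsetP ancw_sub x).
have sw' x := introT implyP (subsetP ancw'_sub x).
split=> //.
(* The common ancestor of [a] and [w] is the exit [y] if that is above [a], and otherwise the upper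
   one of [e] and [y], which are both above [b]. *)
- have [y [yw yA _]] := exA; move: yA; rewrite in_setD => /andP[yU].
  rewrite in_setU => /orP[ya|yb]; first by exists y.
  have [ey|ye] := anc_total eb yb; first by exists e; split=> //; exact: anc_trans ey.
  by exists y; split=> //; apply: anc_trans ea ye.
(* The same choice for [q1] and [w']. Ancestors of [w] are in [X] or in [hull a b], so [d] and [z]
   are not among them. *)
- have [z [zw zB _]] := exB; move: zB; rewrite in_setD => /andP[zU]; rewrite in_setU => zq.
  have dw : d \notin anc w.
    apply/negP => dw; move: dU (dX d) (sw d); rewrite dw /hull => dU' dX' sw''.
    have dh : d \in anc q1 by []; move: dU' dX' sw'' dh; set_cases.
  have zw0 : z \notin anc w.
    apply/negP => zw0; move: zU zq (dX z) (sw z); rewrite zw0 /hull; set_cases.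
  have NU v : v \notin U :|: hull a b -> v \notin anc w -> v \notin U :|: hull a w.
    by rewrite /hull; set_cases.
  case/orP: zq => zq; first by exists z; split=> //; exact: NU.
  have [dz|zd] := anc_total dq2 zq.
    by exists d; split=> //; [exact: anc_trans dz|exact: NU].
  by exists z; split=> //; [exact: anc_trans zd|exact: NU].
- move=> x /CX; move: (dX x); rewrite /M /hull; set_cases.
- exact: quad_link1 Q.
- by left.
- by move=> x _; rewrite in_set0.
- move=> x xO; move: (dX x) (quad_O1 Q xO) (sw x) (sw' x) (introT implyP (CX x)).
  by rewrite /M /hull; set_cases.
- by move=> x; rewrite in_set0.
Qed.

End Chord.

Lemma exits_in (X S : {set V}) x : r \notin X -> nb X \subset S -> x \in X -> exits X S x.
Proof.
move=> rX /subsetP sS xX.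
have [z [zx [zX pX] _ Gz zP]] := anc_exit T (P := fun x => x \in X) xX (anc_root T x) rX.
exists (par z); split; first exact: anc_upclosed.
  by apply: sS; apply: (@mem_nb _ _ _ z).
move=> t tx pt; have [tz|zt] := anc_total tx zx; last by left; exact: zP.
case: (ancE tz) => [->|tp]; first by left.
by right; exact: (anc_anti T pt tp).
Qed.

(** A component with all neighbours on one of the two new boundaries falls under [chord_quad],
    possibly after exchanging the ends. Any other one has a neighbour at each end, against
    [chord_K33]. *)
Lemma chord_split U a b q1 q2 O1 O2 X w w' x :
  quad_region U a b q1 q2 O1 O2 X -> G w w' ->
  exits X (hull a b :\: U) w -> exits X (hull q1 q2 :\: (U :|: hull a b)) w' ->
  w \in X \/ w' \in X -> x \in X :\: (X :&: hull w w') ->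
  let C := comp (X :\: (X :&: hull w w')) x in
  quad_region U a w q1 w' O1 set0 C \/ quad_region U b w q2 w' O2 set0 C.
Proof.
move=> Q ww' exA exB inX xM C.
have sMX : X :&: hull w w' \subset X by exact: subsetIl.
have cC : conn C by exact: conn_comp.
have sC : C \subset X :\: (X :&: hull w w') by exact: comp_sub.
have sN : nb C \subset nb X :|: (X :&: hull w w') by exact: nb_comp.
have tMC : touch (X :&: hull w w') C.
  by apply: touch_comp => //; [exact: quad_conn Q|exact: chord_neq0].
have [s1|/subsetPn[s sNs sF]] := boolP (nb C \subset (hull a w :|: hull q1 w') :\: U).
  by left; exact: (chord_quad Q ww' exA exB).
have [s2|/subsetPn[t tN tF]] := boolP (nb C \subset (hull b w :|: hull q2 w') :\: U).
  right; apply: (chord_quad (quad_sym Q) ww') => //; rewrite ?(hullC b a) ?(hullC q2 q1) //.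
have Q' := quad_sym Q.
have sR := chord_nb_side Q sN sNs sF.
have tL := chord_nb_side Q' sN tN tF.
rewrite (hullC b a) in tL.
by case: (chord_K33 Q ww' exA exB inX cC sC tMC sN sNs tN sR tL).
Qed.

End States.

(** * Degenerate regions and their reduction to quadrilaterals *)

Section Regions.
Variables (V : finType) (G : rel V).
Hypothesis Gsym : symmetric G.
Variables (par : V -> V) (r : V) (lay : V -> nat).
Hypothesis T : rooted_tree G par r lay.
Hypothesis noK33 : forall A B, ~ K33_minor G A B.

Local Notation anc := (anc par).
Local Notation upclosed := (upclosed par).
Local Notation hull := (hull par).
Local Notation conn := (conn G).
Local Notation touch := (touch G).
Local Notation nb := (nb G).
Local Notation comp := (comp G).
Local Notation link := (link G).
Local Notation quad_region := (quad_region G par).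
Local Notation exits := (exits par).

Record chain_region u (X : {set V}) : Prop := ChainRegion {
  chain_conn : conn X;
  chain_disj : forall x, x \in X -> x \notin anc u;
  chain_nb : nb X \subset anc u }.

(** What a quadrilateral region becomes when one of its subtrees has no neighbour of [X]: that
    subtree and the links merge into [O]. *)
Record hull_region (U : {set V}) a b (O X : {set V}) : Prop := HullRegion {
  hull_region_up : upclosed U;
  hull_region_e : exists e, [/\ e \in anc a, e \in anc b & e \notin U];
  hull_region_conn : conn X;
  hull_region_disj : forall x, x \in X -> x \notin U :|: hull a b;
  hull_region_nb : nb X \subset hull a b :\: U;
  hull_region_connO : conn O;
  hull_region_a : exists2 y1, y1 \in O & G a y1;
  hull_region_b : exists2 y1, y1 \in O & G b y1;
  hull_region_O : forall x, x \in O -> x \notin X :|: (hull a b :\: U) }.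

Lemma lowest (S : {set V}) a x : S \subset anc a -> x \in S ->
  exists2 u, u \in S & S \subset anc u.
Proof.
move=> /subsetP Sa xS; case: (@arg_maxnP _ x (mem S) lay xS) => u uS umax.
exists u => //; apply/subsetP => v vS.
have [//|uv] := anc_total (Sa _ vS) (Sa _ uS).
have [->|NE] := eqVneq u v; first exact: anc_refl.
by have := anc_lay T uv NE; rewrite ltnNge; have /= -> := umax _ vS.
Qed.

(* If the boundary of [X] consists of two vertical paths closed by [O], its lowest
   vertex [u] on one of them becomes the whole of [B] in a quadrilateral region. *)
Lemma hull_region_quad U a b O X : hull_region U a b O X ->
  [\/ chain_region a X, chain_region b X | exists u O',
    [/\ quad_region U (par u) b u u set0 O' X,
        nb X :&: (hull (par u) b :\: U) != set0 &
        nb X :&: (hull u u :\: (U :|: hull (par u) b)) != set0]].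
Proof.
move=> P; have [e [ea eb eU]] := hull_region_e P.
have dX x := introT implyP (@hull_region_disj _ _ _ _ _ P x).
have dO x := introT implyP (@hull_region_O _ _ _ _ _ P x).
have sN := subsetP (hull_region_nb P).
have [sb|/subsetPn[v vN vb]] := boolP (nb X \subset anc b).
  apply: Or32; split=> //; first exact: hull_region_conn P.
  by move=> x xX; move: (dX x); rewrite xX /hull; set_cases.
have [sa|/subsetPn[v' v'N v'a]] := boolP (nb X \subset anc a).
  apply: Or31; split=> //; first exact: hull_region_conn P.
  by move=> x xX; move: (dX x); rewrite xX /hull; set_cases.
have va : v \in anc a by move: (sN _ vN) vb; rewrite /hull; set_cases.
have v'b : v' \in anc b by move: (sN _ v'N) v'a; rewrite /hull; set_cases.
have vS : v \in nb X :&: anc a by rewrite in_setI vN.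
(* As [v] is above [u] and not above [b], neither is [u]. *)
have [u] := lowest (subsetIr _ _) vS; rewrite in_setI => /andP[uN ua] /subsetP low.
have vu : v \in anc u by apply: low; rewrite in_setI vN.
have ub : u \notin anc b by apply: contra vb => ub; apply: anc_trans vu.
have ur : u != r by apply: contraNneq ub => ->; exact: (anc_root T).
have uU : u \notin U by move: (sN _ uN); rewrite /hull; set_cases.
have up : u \notin anc (par u) := anc_parF T ur.
have eu : e \in anc u.
  by have [ue|//] := anc_total ua ea; rewrite (anc_trans eb ue) in ub.
have epu : e \in anc (par u).
  by case: (ancE eu) => // E; rewrite -E eb in ub.
have spu x : (x \in anc (par u)) ==> (x \in anc u).
  by apply/implyP => xp; apply: anc_trans (anc_par par u) xp.
have spa x : (x \in anc u) ==> (x \in anc a).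
  by apply/implyP => xp; apply: anc_trans ua xp.
have cau : conn (anc a :\: anc u) by apply: (conn_vertical Gsym T); exact: anc_upclosed.
have below x : (x \in anc a) && (x \notin anc u) ==> (x \notin anc b).
  apply/implyP => /andP[xa xu]; have [xu'|ux] := anc_total xa ua.
    by rewrite xu' in xu.
  by apply: contra ub => xb; apply: anc_trans ux.
have ue x : (x \in anc u) ==> (x == u) || (x \in anc (par u)).
  by apply/implyP => /ancE [->|->]; rewrite ?eqxx ?orbT.
have [y1 y1O ay1] := hull_region_a P; have [y2 y2O by2] := hull_region_b P.
(* The part of the path from [a] below [u] joins [O] and links [b] to [u]; the other link is the
   tree edge from [u] to [par u]. *)
apply: Or33; exists u, (O :|: (anc a :\: anc u)); split; last 2 first.
- by apply/set0Pn; exists v'; move: (sN _ v'N) (v'N) v'b; rewrite /hull; set_cases.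
- by apply/set0Pn; exists u; rewrite !inS uN anc_refl (negbTE uU) (negbTE up) (negbTE ub).
split=> //.
- exact: hull_region_up P.
- by exists e.
- by exists u; rewrite !inS anc_refl (negbTE uU) (negbTE up) (negbTE ub).
- exact: hull_region_conn P.
- move=> x xX; move: (dX x) (spa x) (spu x); rewrite xX /hull; set_cases.
- apply/subsetP => x xN; move: (sN _ xN) (ue x) (introT implyP (low x)); rewrite !inS xN.
  by rewrite /hull; set_cases.
- by left; rewrite Gsym (par_edge T ur).
- right; split.
  + have [E|/set0Pn[x xa]] := eqVneq (anc a :\: anc u) set0.
      by rewrite E setU0; exact: hull_region_connO P.
    apply: (connU Gsym) => //; first exact: hull_region_connO P.
    have aB := bottom_vertical (@anc_upclosed _ _ u) xa.
    by exists y1, a; rewrite Gsym.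
  + by exists y2 => //; rewrite in_setU y2O.
  + have [au|au] := boolP (a \in anc u).
      by rewrite (anc_anti T ua au) in ay1 *; exists y1 => //; rewrite in_setU y1O.
    have := anc_exit T (P := fun x => x \notin anc u) au ua.
    rewrite negbK anc_refl => /(_ isT)[z [za [zu]]]; rewrite negbK => pu upz Gz _.
    exists z; first by rewrite in_setU in_setD zu za orbT.
    by rewrite Gsym -(anc_anti T upz pu).
- by move=> x; rewrite in_set0.
- by move=> x; rewrite in_set0.
- move=> x; move: (dX x) (dO x) (spa x) (spu x) (ue x) (below x).
  by rewrite /hull; set_cases.
Qed.

Lemma link_join a b q1 q2 (O1 O2 H : {set V}) : conn H -> q1 \in H -> q2 \in H ->
  link a q1 O1 -> link b q2 O2 ->
  [/\ conn (H :|: O1 :|: O2), exists2 y1, y1 \in H :|: O1 :|: O2 & G a y1 &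
      exists2 y1, y1 \in H :|: O1 :|: O2 & G b y1].
Proof.
have aux a' q H' O' : conn H' -> q \in H' -> link a' q O' ->
    conn (H' :|: O') /\ exists2 y1, y1 \in H' :|: O' & G a' y1.
  move=> cH qH [[aq ->]|[cO [y1 y1O ay1] [y2 y2O qy2]]].
    by rewrite setU0; split=> //; exists q.
  split; first by apply: (connU Gsym) => //; exists q, y2.
  by exists y1; rewrite // in_setU y1O orbT.
move=> cH q1H q2H /(aux _ _ _ _ cH q1H)[cH1 [y1 oH ay1]] l2.
have q2H1 : q2 \in H :|: O1 by rewrite in_setU q2H.
have [cH2 bo] := aux _ _ _ _ cH1 q2H1 l2.
by split=> //; exists y1; rewrite // in_setU oH.
Qed.

Lemma hull_bottom a b e (U : {set V}) : upclosed U -> e \in anc a -> e \in anc b -> e \notin U ->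
  a \in hull a b :\: U /\ b \in hull a b :\: U.
Proof.
move=> uU ea eb eU; rewrite !inS !anc_refl !orbT !andbT.
by split; apply: contra eU => h; [apply: upclosed_anc uU h ea|apply: upclosed_anc uU h eb].
Qed.

Lemma quad_hull_region U a b q1 q2 O1 O2 X : quad_region U a b q1 q2 O1 O2 X ->
  [\/ nb X :&: (hull a b :\: U) != set0 /\
      nb X :&: (hull q1 q2 :\: (U :|: hull a b)) != set0,
      hull_region U a b (hull q1 q2 :\: (U :|: hull a b) :|: O1 :|: O2) X |
      hull_region (U :|: hull a b) q1 q2 (hull a b :\: U :|: O1 :|: O2) X].
Proof.
move=> Q; have [e [ea eb eU]] := quad_e Q; have [d [dq1 dq2 dU]] := quad_d Q.
have uU := quad_up Q; have uA := upclosedU uU (@hull_upclosed _ par a b).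
have dX x := introT implyP (@quad_disj _ _ _ _ _ _ _ _ _ _ _ Q x).
have dO1 x := introT implyP (@quad_O1 _ _ _ _ _ _ _ _ _ _ _ Q x).
have dO2 x := introT implyP (@quad_O2 _ _ _ _ _ _ _ _ _ _ _ Q x).
have sN := subsetP (quad_nb Q).
have hullT (U' : {set V}) x y : (hull x y :&: setT) :\: U' = hull x y :\: U' by rewrite setIT.
have uT : upclosed setT by move=> x; rewrite !in_setT.
have cA : conn (hull a b :\: U).
  by rewrite -hullT; apply: (conn_hull Gsym T uU uT ea eb _ eU); rewrite in_setT.
have cB : conn (hull q1 q2 :\: (U :|: hull a b)).
  by rewrite -hullT; apply: (conn_hull Gsym T uA uT dq1 dq2 _ dU); rewrite in_setT.
have [aA bA] := hull_bottom uU ea eb eU.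
have [q1B q2B] := hull_bottom uA dq1 dq2 dU.
have [cO aO bO] := link_join cB q1B q2B (quad_link1 Q) (quad_link2 Q).
have [cO' aO' bO'] := link_join cA aA bA
  (link_sym Gsym (quad_link1 Q)) (link_sym Gsym (quad_link2 Q)).
have [EB|nB] := eqVneq (nb X :&: (hull q1 q2 :\: (U :|: hull a b))) set0.
  apply: Or32; split=> //; first by exists e.
  - exact: quad_conn Q.
  - by move=> x xX; move: (dX x); rewrite xX /hull; set_cases.
  - apply/subsetP => x xN; move: (sN _ xN) (in_set0 x); rewrite -EB !inS xN.
    by rewrite /hull; set_cases.
  - by move=> x; move: (dX x) (dO1 x) (dO2 x); rewrite /hull; set_cases.
have [EA|nA] := eqVneq (nb X :&: (hull a b :\: U)) set0; last exact: Or31.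
apply: Or33; split=> //; first by exists d.
- exact: quad_conn Q.
- by move=> x xX; move: (dX x); rewrite xX /hull; set_cases.
- apply/subsetP => x xN; move: (sN _ xN) (in_set0 x); rewrite -EA !inS xN.
  by rewrite /hull; set_cases.
- by move=> x; move: (dX x) (dO1 x) (dO2 x); rewrite /hull; set_cases.
Qed.

End Regions.

(** * Separators of regions *)

Section Step.
Variables (V : finType) (G : rel V).
Hypothesis Gsym : symmetric G.
Variables (par : V -> V) (r : V) (lay : V -> nat).
Hypothesis T : rooted_tree G par r lay.
Hypothesis noK33 : forall A B, ~ K33_minor G A B.
Hypothesis Gconn : conn G setT.

Local Notation anc := (anc par).
Local Notation hull := (hull par).
Local Notation nb := (nb G).
Local Notation comp := (comp G).
Local Notation quad_region := (quad_region G par).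
Local Notation chain_region := (chain_region G par).
Local Notation hull_region := (hull_region G par).

Definition region (X : {set V}) : Prop :=
  (exists u, chain_region u X) \/ (exists U a b q1 q2 O1 O2, quad_region U a b q1 q2 O1 O2 X).

(** The bound counts [nb X] along with [M], because vertices of both become earlier neighbours of
    the vertices of [M]. *)
Definition splits (k : nat) (P : {set V} -> Prop) (X : {set V}) : Prop :=
  exists M : {set V}, [/\ M \subset X, M != set0,
    forall i, #|[set y in nb X :|: M | lay y == i]| <= k &
    forall x, x \in X :\: M -> P (comp (X :\: M) x)].

Lemma card_anc_layer (s : seq V) (S : {set V}) i :
  (forall x, x \in S -> has (fun w => x \in anc w) s) ->
  #|[set y in S | lay y == i]| <= size s.
Proof.
elim: s S => [|w s IH] S Ss.
  by rewrite leqn0 cards_eq0; apply/eqP/setP => x; rewrite !inE; apply/negP => /andP[/Ss].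
set S1 := [set y in S | lay y == i] :&: anc w.
have le1 : #|S1| <= 1.
  apply/card_le1_eqP => x y; rewrite !in_setI => /andP[xS xw] /andP[yS yw].
  apply: (anc_lay_inj T yw xw); move: xS yS; rewrite !in_set.
  by move=> /andP[_ /eqP ->] /andP[_ /eqP ->].
rewrite -(cardsID (anc w)) -[(size _)]add1n; apply: leq_add => //.
apply: leq_trans (IH (S :\: anc w) _).
  apply: subset_leq_card; apply/subsetP => x; rewrite in_setD in_set => /and3P[xw xS xi].
  by rewrite in_set in_setD xw xS.
by move=> x; rewrite in_setD => /andP[xw /Ss /=]; rewrite (negbTE xw).
Qed.

Lemma nb_neq0 (X : {set V}) : X != set0 -> r \notin X -> nb X != set0.
Proof.
move=> /set0Pn[x xX] rX.
have [u [v [uX vX /and3P[_ _ uv]]]] :=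
  connect_exit (Gconn (in_setT x) (in_setT r)) (P := fun x => x \in X) xX rX.
by apply/set0Pn; exists v; exact: mem_nb uv vX.
Qed.

(** Let [u0] be the lowest neighbour of [X], and cut along the path from a vertex [w] of [X]
    adjacent to it. If [u0] is above [w], this path bounds every component; otherwise the boundary
    is a quadrilateral with [B] reduced to [u0], closed by its edges to [par u0] and [w]. *)
Lemma chain_splits u X : X != set0 -> chain_region u X -> splits 8 region X.
Proof.
move=> Xne [cX dX sN].
have rX : r \notin X by apply/negP => /dX; rewrite (anc_root T).
have /set0Pn[v vN] := nb_neq0 Xne rX.
have [u0 u0N sN0] := lowest T sN vN.
have [u0X [w wX Gw]] := nbP u0N.
have dX0 x : x \in X -> x \notin anc u0.
  move=> /dX; apply: contra => xu; apply: anc_trans xu; exact: (subsetP sN).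
exists (X :&: anc w); split.
- exact: subsetIl.
- by apply/set0Pn; exists w; rewrite !inS wX anc_refl.
- move=> i; apply: leq_trans (@card_anc_layer [:: u0; w] _ i _) _ => // x /=.
  rewrite !inS => /orP[/(subsetP sN0) ->|/andP[_ ->]] //; by rewrite orbT.
move=> x xM; set C := comp _ x.
have sC : C \subset X :\: (X :&: anc w) by exact: comp_sub.
have sNC : nb C \subset nb X :|: (X :&: anc w) by apply: nb_comp; exact: subsetIl.
have cC : conn G C by exact: conn_comp.
have CX y : (y \in C) ==> (y \in X) && (y \notin anc w).
  by apply/implyP => /(subsetP sC); set_cases.
have [u0w|u0w] := boolP (u0 \in anc w).
  left; exists w; split=> //.
    by move=> y yC; move: (CX y); rewrite yC => /andP[].
  apply/subsetP => y /(subsetP sNC); rewrite !inS => /orP[/(subsetP sN0)|/andP[_ ->]] //.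
  exact: anc_trans u0w.
right; exists set0, (par u0), w, u0, u0, set0, set0.
have ur : u0 != r by apply: contraNneq u0w => ->; exact: (anc_root T).
have up : u0 \notin anc (par u0) := anc_parF T ur.
split=> //.
- exact: upclosed0.
- by exists r; rewrite !(anc_root T) in_set0.
- by exists u0; rewrite !inS anc_refl (negbTE up) (negbTE u0w).
- move=> y yC; move: (CX y); rewrite yC => /andP[yX yw].
  have yu := dX0 _ yX; have yp : y \notin anc (par u0).
    by apply: contra yu => yp; apply: anc_trans (anc_par par u0) yp.
  by rewrite !inS (negbTE yw) (negbTE yu) (negbTE yp).
- apply/subsetP => y /(subsetP sNC); rewrite !inS => /orP[/(subsetP sN0) ->|/andP[_ ->]].
    by rewrite !orbT.
  by rewrite !orbT.
- by left; rewrite Gsym (par_edge T ur).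
- by left.
- by move=> y; rewrite in_set0.
- by move=> y; rewrite in_set0.
- by move=> y; rewrite in_set0.
Qed.

Lemma exits1 (X S : {set V}) v : v \in S -> exits par X S v.
Proof.
move=> vS; exists v; split=> //; first exact: anc_refl.
by move=> t tv vt; right; exact: (anc_anti T vt tv).
Qed.

(** Colour a vertex of [X] by the subtree in which its vertical path ends. Either a neighbour of [A]
    ends in [B], or a neighbour of [B] ends in [A], or the colour changes across an edge inside the
    connected set [X]. *)
Lemma quad_chord U a b q1 q2 O1 O2 X : quad_region U a b q1 q2 O1 O2 X ->
  nb X :&: (hull a b :\: U) != set0 ->
  nb X :&: (hull q1 q2 :\: (U :|: hull a b)) != set0 ->
  exists w w', [/\ G w w', exits par X (hull a b :\: U) w,
    exits par X (hull q1 q2 :\: (U :|: hull a b)) w' & w \in X \/ w' \in X].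
Proof.
move=> Q /set0Pn[v0]; rewrite in_setI => /andP[v0N v0A] /set0Pn[v1].
rewrite in_setI => /andP[v1N v1B].
have rX : r \notin X by apply/negP => /(quad_disj Q); rewrite !inS (anc_root T) orbT.
have : forall x, exists c : bool, x \in X ->
    if c then exits par X (hull a b :\: U) x
    else exits par X (hull q1 q2 :\: (U :|: hull a b)) x.
  move=> x; case: (boolP (x \in X)) => [xX|]; last by exists true.
  have [y [yx yS yt]] := exits_in T rX (quad_nb Q) xX.
  have [yA|yA] := boolP (y \in hull a b :\: U).
    by exists true => _; exists y.
  exists false => _; exists y; split=> //.
  by move: yS yA; rewrite /hull; set_cases.
move=> /fin_all_exists[c cP].
have [v0X [x0 x0X Gx0]] := nbP v0N; have [v1X [x1 x1X Gx1]] := nbP v1N.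
have [c0|c0] := boolP (c x0); last first.
  exists v0, x0; rewrite Gsym; split=> //; [exact: exits1| |by right].
  by have := cP x0 x0X; rewrite (negbTE c0).
have [c1|c1] := boolP (c x1).
  exists x1, v1; split=> //; [|exact: exits1|by left].
  by have := cP x1 x1X; rewrite c1.
have [w [w' [cw cw' /and3P[wX w'X Gww']]]] :=
  connect_exit (quad_conn Q x0X x1X) c0 c1.
exists w, w'; split=> //; last by left.
  by have := cP w wX; rewrite cw.
by have := cP w' w'X; rewrite (negbTE cw').
Qed.

Lemma quad_splits U a b q1 q2 O1 O2 X : quad_region U a b q1 q2 O1 O2 X ->
  nb X :&: (hull a b :\: U) != set0 ->
  nb X :&: (hull q1 q2 :\: (U :|: hull a b)) != set0 -> splits 8 region X.
Proof.
move=> Q nA nB; have [w [w' [ww' exA exB inX]]] := quad_chord Q nA nB.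
exists (X :&: hull w w'); split.
- exact: subsetIl.
- exact: chord_neq0.
(* Four vertical paths bound [X] and two form the chord; the bound 8 matches the three bits of a
   colour. *)
- move=> i; apply: leq_trans (@card_anc_layer [:: a; b; q1; q2; w; w'] _ i _) _ => // x.
  rewrite in_setU => /orP[/(subsetP (quad_nb Q))|]; rewrite /= /hull; set_cases.
- move=> x xM; right.
  have [Q'|Q'] := chord_split Gsym T noK33 Q ww' exA exB inX xM.
    by exists U, a, w, q1, w', O1, set0.
  by exists U, b, w, q2, w', O2, set0.
Qed.

(** A quadrilateral with neighbours on both subtrees is cut by a chord. Any other one is a hull
    region, hence a chain region or another quadrilateral, this time with neighbours on both
    subtrees. *)
Lemma region_splits X : X != set0 -> region X -> splits 8 region X.
Proof.
move=> Xne [[u]|[U [a [b [q1 [q2 [ O1 [ O2 Q]]]]]]]]; first exact: chain_splits.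
have aux U' a' b' O : hull_region U' a' b' O X -> splits 8 region X.
  case/(hull_region_quad Gsym T) => [||[u [ O' [Q' nA nB]]]]; [exact: chain_splits..|].
  exact: quad_splits Q' nA nB.
by case: (quad_hull_region Gsym T Q) => [[nA nB]|/aux|/aux] //; exact: (quad_splits Q nA nB).
Qed.

(** The root alone is the first separator, and it is its own vertical path. *)
Lemma setT_splits : splits 8 region setT.
Proof.
exists [set r]; split; first exact: subsetT.
- by apply/set0Pn; exists r; rewrite in_set1.
- move=> i; apply: leq_trans (@card_anc_layer [:: r] _ i _) _ => // x /=.
  rewrite in_setU in_set1 => /orP[/nbP[]|/eqP ->]; first by rewrite in_setT.
  by rewrite anc_refl.
move=> x xM; left; exists r.
have sNC := @nb_comp _ G setT [set r] x (subsetT _).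
have rE y : y \in anc r -> y = r by move=> yr; rewrite (anc_anti T yr (anc_root T y)).
split; first exact: conn_comp.
- move=> y /(subsetP (comp_sub _ _ _)); rewrite !inS => /andP[yr _].
  by apply: contra yr => /rE ->.
- apply/subsetP => y /(subsetP sNC); rewrite in_setU in_set1 => /orP[/nbP[]|/eqP ->].
    by rewrite in_setT.
  exact: anc_refl.
Qed.

End Step.

(** * Elimination orders and breadth-first trees *)

Section Elimination.
Variables (V : finType) (G : rel V) (lay : V -> nat) (k : nat).
Hypothesis Gsym : symmetric G.
Hypothesis Girr : irreflexive G.

Local Notation nb := (nb G).
Local Notation comp := (comp G).

(* [B x] is the set of earlier neighbours of [x] in a chordal supergraph of [G] and
   [rho] the time at which a vertex is added; the vertices of [nb X] come first. *)
Record elimination (X : {set V}) (B : V -> {set V}) (rho : V -> nat) : Prop := Elimination {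
  elim_sub : forall x, x \in X -> B x \subset nb X :|: X;
  elim_lt : forall x y, x \in X -> y \in X -> y \in B x -> rho y < rho x;
  elim_clique : forall x y z, x \in X -> y \in B x -> z \in B x -> y != z ->
    [|| (y \in nb X) && (z \in nb X), (z \in X) && (y \in B z) | (y \in X) && (z \in B y)];
  elim_edge : forall x y, x \in X -> G x y -> (y \in B x) || (y \in X) && (x \in B y);
  elim_card : forall x, x \in X -> #|[set y in B x | lay y == lay x]| < k }.

(** By induction on the size of [X]: the separator comes first, in the order of its enumeration, and
    each component follows with its own order. Neighbours of a component are in [nb X :|: M], where
    cliques are already accounted for. *)
Lemma splits_elimination (P : {set V} -> Prop) :
  (forall X, X != set0 -> P X -> splits G lay k P X) ->
  forall X, P X -> exists B rho, elimination X B rho.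
Proof.
move=> Psplit X; have [n] := ubnP #|X|; elim: n X => // n IH X /ltnSE le_Xn PX.
have [->|Xne] := eqVneq X set0.
  by exists (fun=> set0), (fun=> 0); split=> [x|x y|x y z|x y|x]; rewrite in_set0.
have [M [MX Mne cardM PC]] := Psplit X Xne PX.
(* The orders are indexed by sets, with dummy values at sets that are no component, so that all
   vertices of a component use the same order. *)
have : forall C : {set V}, exists p : (V -> {set V}) * (V -> nat),
    (exists2 x, x \in X :\: M & C = comp (X :\: M) x) -> elimination C p.1 p.2.
  move=> C; have [/existsP[x /andP[xM /eqP CE]]|noC] :=
    boolP [exists x, (x \in X :\: M) && (C == comp (X :\: M) x)].
    rewrite {C}CE; have [||B [rho E]] := IH (comp (X :\: M) x); last by exists (B, rho).
      apply: leq_trans le_Xn; apply: proper_card; apply/properP; split.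
        exact: subset_trans (comp_sub _ _ _) (subsetDl _ _).
      have /set0Pn[m mM] := Mne; exists m; first exact: (subsetP MX).
      by apply/negP => /(subsetP (comp_sub _ _ _)); rewrite inS mM.
    exact: PC.
  exists (fun=> set0, fun=> 0) => -[x xM CE]; case/negP: noC.
  by apply/existsP; exists x; rewrite xM CE eqxx.
move=> /fin_all_exists[p pP].
pose C x := comp (X :\: M) x.
have pC x : x \in X :\: M -> elimination (C x) (p (C x)).1 (p (C x)).2.
  by move=> xM; apply: pP; exists x.
pose idx x := index x (enum M).
pose B x := if x \in M then nb X :|: [set y in M | idx y < idx x] else (p (C x)).1 x.
pose rho x := if x \in M then idx x else #|M| + (p (C x)).2 x.
have BM x y : x \in M -> (y \in B x) = (y \in nb X) || (y \in M) && (idx y < idx x).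
  by move=> xM; rewrite /B xM in_setU [X in _ || X]in_set.
have CX x y : y \in C x -> y \in X :\: M by exact: (subsetP (comp_sub _ _ _)).
have nbC x y : y \in nb (C x) -> (y \in nb X) || (y \in M).
  by move=> /(subsetP (nb_comp G x MX)); rewrite in_setU.
have nbX y : y \in nb X -> y \notin X by move=> /nbP[].
have Csame x y : y \in C x -> C y = C x by exact: comp_eq.
have Cref x : x \in X :\: M -> x \in C x by exact: comp_refl.
have BC x : x \notin M -> B x = (p (C x)).1 x by rewrite /B => /negbTE ->.
have XM x : x \in X -> x \notin M -> x \in X :\: M by move=> xX xM; rewrite inS xM.
have idx_total y z : y \in M -> z \in M -> y != z -> (idx y < idx z) || (idx z < idx y).
  move=> yM zM NE; case: ltngtP => // E; case/eqP: NE.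
  have nthE t : t \in M -> nth y (enum M) (idx t) = t.
    by move=> tM; apply: nth_index; rewrite mem_enum.
  by rewrite -(nthE y yM) E nthE.
have Bsub x y : x \in X :\: M -> y \in B x -> (y \in nb (C x)) || (y \in C x).
  move=> xM; rewrite BC; last by move: xM; rewrite inS => /andP[].
  by move=> /(subsetP (elim_sub (pC x xM) (Cref x xM))); rewrite in_setU.
have MMP y z : y \in M -> z \in M -> y != z ->
    [|| (y \in nb X) && (z \in nb X), (z \in X) && (y \in B z) | (y \in X) && (z \in B y)].
  move=> yM zM NE; rewrite (subsetP MX _ zM) (subsetP MX _ yM) !BM // yM zM /=.
  by case/orP: (idx_total _ _ yM zM NE) => ->; rewrite !orbT.
exists B, rho; split.
- move=> x xX; apply/subsetP => y; rewrite in_setU.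
  have [xM|xM] := boolP (x \in M).
    rewrite BM // => /orP[->//|/andP[/(subsetP MX) -> _]].
    by rewrite orbT.
  move=> /(Bsub x y (XM x xX xM)) => /orP[/nbC/orP[->//|/(subsetP MX) ->]|/CX].
    by rewrite orbT.
  by rewrite inS => /andP[_ ->]; rewrite orbT.
- move=> x y xX yX; have [xM|xM] := boolP (x \in M).
    by rewrite BM // /rho xM => /orP[/nbX|/andP[-> //]]; rewrite yX.
  move=> yB; have xXM := XM x xX xM.
  have [yM|yM] := boolP (y \in M).
    rewrite /rho yM (negbTE xM); apply: (@leq_trans #|M|); last exact: leq_addr.
    by rewrite cardE index_mem mem_enum.
  have yC : y \in C x.
    case/orP: (Bsub x y xXM yB) => // /nbC; rewrite (negbTE yM) orbF => /nbX.
    by rewrite yX.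
  rewrite /rho (negbTE yM) (negbTE xM) (Csame _ _ yC) ltn_add2l.
  by rewrite BC // in yB; exact: (elim_lt (pC x xXM) (Cref x xXM) yC yB).
- move=> x y z xX; have [xM|xM] := boolP (x \in M).
    rewrite (BM x y xM) (BM x z xM) => yB zB NE; move: yB zB.
    case/orP=> [yN|/andP[yM yi]] /orP[zN|/andP[zM zi]]; first by rewrite yN zN.
    - by rewrite (subsetP MX _ zM) (BM z) // yN orbT.
    - by rewrite (subsetP MX _ yM) (BM y) // zN !orbT.
    exact: MMP.
  have xXM := XM x xX xM; have EC := pC x xXM.
  move=> yB zB NE; have yB' := yB; have zB' := zB; rewrite BC // in yB' zB'.
  have inC t s : t \in C x -> s \in (p (C x)).1 t -> (t \in X) && (s \in B t).
    move=> tC sB; move: (CX _ _ tC); rewrite inS => /andP[tM ->] /=.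
    by rewrite BC // (Csame _ _ tC).
  case/or3P: (elim_clique EC (Cref x xXM) yB' zB' NE) => /andP[].
  + move=> /nbC/orP[yN|yM] /nbC/orP[zN|zM]; first by rewrite yN zN.
    * by rewrite (subsetP MX _ zM) (BM z) // yN orbT.
    * by rewrite (subsetP MX _ yM) (BM y) // zN !orbT.
    exact: MMP.
  + by move=> zC yz; rewrite (inC z y zC yz) orbT.
  + by move=> yC zy; rewrite (inC y z yC zy) !orbT.
- move=> x y xX Gxy; have [xM|xM] := boolP (x \in M).
    have [yX|yX] := boolP (y \in X); last by rewrite BM // (mem_nb xX Gxy yX).
    have [E|NE] := eqVneq x y; first by rewrite E Girr in Gxy.
    have [yM|yM] := boolP (y \in M).
      rewrite !BM // xM yM /=.
      by case/orP: (idx_total _ _ xM yM NE) => ->; rewrite !orbT.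
    have yXM := XM y yX yM; rewrite /= (BC y yM) orbC.
    rewrite Gsym in Gxy; case/orP: (elim_edge (pC y yXM) (Cref y yXM) Gxy) => [->//|].
    by move=> /andP[/CX]; rewrite inS xM.
  have xXM := XM x xX xM; have EC := pC x xXM.
  case/orP: (elim_edge EC (Cref x xXM) Gxy) => [h|/andP[yC h]]; first by rewrite BC ?h.
  move: (CX _ _ yC); rewrite inS => /andP[yM ->] /=.
  by rewrite (BC y yM) (Csame _ _ yC) h orbT.
move=> x xX; have [xM|xM] := boolP (x \in M); last first.
  by rewrite BC //; apply: (elim_card (pC x (XM x xX xM))); apply: Cref; exact: XM.
(* The inequality is strict because [x] is itself in [M] and in its own layer, but not in [B x]. *)
apply: leq_trans (cardM (lay x)); apply: proper_card; apply/properP; split.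
  apply/subsetP => y; rewrite in_set BM // in_set in_setU.
  by case/andP => /orP[->|/andP[-> _]] ->; rewrite ?orbT.
exists x; first by rewrite in_set in_setU xM orbT eqxx.
rewrite in_set BM // ltnn andbF orbF negb_and.
by apply/orP; left; apply: contraL xX => /nbX.
Qed.

(** Colours are assigned in rounds of increasing [rho]; each vertex avoids the fewer than [k]
    colours of its earlier neighbours in its layer. *)
Lemma greedy_coloring (B : V -> {set V}) (rho : V -> nat) :
  (forall x y, y \in B x -> rho y < rho x) ->
  (forall x, #|[set y in B x | lay y == lay x]| < k) ->
  exists c : V -> 'I_k, forall x y, y \in B x -> lay y = lay x -> c y != c x.
Proof.
move=> Blt Bk.
(* Only a vertex guarantees that ['I_k] has an element, so the empty graph is treated apart. *)
have [x0 _|V0] := pickP (pred_of_simpl (@predT V)); last first.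
  have h : forall x : V, exists c : 'I_k, true by move=> x; have := V0 x.
  by have [c _] := fin_all_exists h; exists c => x; have := V0 x.
pose S x := [set y in B x | lay y == lay x].
suff [c cP] : exists c : V -> 'I_k, forall x, rho x < (\max_x rho x).+1 ->
    forall y, y \in S x -> c y != c x.
  exists c => x y yB E; apply: cP; last by rewrite in_set yB E eqxx.
  by rewrite ltnS leq_bigmax.
elim: (_.+1) => [|n [c IH]].
  by exists (fun=> Ordinal (leq_ltn_trans (leq0n _) (Bk x0))).
have : forall x, exists d : 'I_k, d \notin c @: S x.
  move=> x; have /card_gt0P[d dP] : 0 < #|~: (c @: S x)|.
    by rewrite cardsCs setCK card_ord subn_gt0 (leq_ltn_trans (leq_imset_card _ _)) ?Bk.
  by exists d; rewrite -in_setC.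
move=> /fin_all_exists[d dP]; exists (fun x => if rho x == n then d x else c x).
move=> x; rewrite ltnS leq_eqVlt => /orP[/eqP xn|xn] y yS.
  have yx : rho y < rho x by apply: Blt; move: yS; rewrite in_set => /andP[].
  rewrite xn eqxx -{1}xn (ltn_eqF yx).
  by apply: contraNneq (dP x) => <-; apply: imset_f.
have yx : rho y < rho x by apply: Blt; move: yS; rewrite in_set => /andP[].
by rewrite (ltn_eqF xn) (ltn_eqF (ltn_trans yx xn)); exact: IH.
Qed.

End Elimination.

Section BFS.
Variables (V : finType) (G : rel V) (r : V).
Hypothesis Gsym : symmetric G.
Hypothesis Gconn : forall x y, connect G x y.

(** Here [lay] is the distance from [r], and the parent is the last but one vertex of a shortest
    path from [r]. *)
Lemma bfs_tree : exists par lay, rooted_tree G par r lay /\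
  forall x y, G x y -> lay y <= (lay x).+1.
Proof.
have dist x : exists n, [exists p : n.-tuple V, path G r p && (last r p == x)].
  have /connectP[p pp ->] := Gconn r x.
  by exists (size p); apply/existsP; exists (in_tuple p); rewrite pp eqxx.
pose lay x := ex_minn (dist x).
have lay_le p : path G r p -> lay (last r p) <= size p.
  move=> pp; rewrite /lay; case: ex_minnP => m _; apply.
  by apply/existsP; exists (in_tuple p); rewrite pp eqxx.
have layP x : exists p, [/\ path G r p, last r p = x & size p = lay x].
  rewrite /lay; case: ex_minnP => m /existsP[p /andP[pp /eqP pl]] _.
  by exists p; rewrite size_tuple.
have layS x y : G x y -> lay y <= (lay x).+1.
  move=> xy; have [p [pp pl <-]] := layP x.
  have := lay_le (rcons p y); rewrite rcons_path pp pl xy last_rcons size_rcons.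
  exact.
have : forall x, exists y, if x == r then y = r else G x y && (lay y < lay x).
  move=> x; case: eqP => [|/eqP NE]; first by exists r.
  have [p [pp pl ps]] := layP x; case/lastP: p pp pl ps => [|p y] /=.
    by move=> _ E; rewrite E eqxx in NE.
  rewrite rcons_path last_rcons size_rcons => /andP[pp xy] E <-.
  by exists (last r p); rewrite -E Gsym xy ltnS lay_le.
move=> /fin_all_exists[par parP]; exists par, lay; split=> //; split.
- by have := parP r; rewrite eqxx.
- by move=> x NE; have := parP x; rewrite (negbTE NE) => /andP[].
- by move=> x NE; have := parP x; rewrite (negbTE NE) => /andP[].
Qed.

End BFS.

(** * Crossing parity of polygons *)

Section Segments.
Local Open Scope ring_scope.
Variable R : realFieldType.
Implicit Types p q z : R * R.

Definition lex p q : bool := (p.1 < q.1) || (p.1 == q.1) && (p.2 < q.2).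

(** Twice the signed area of the triangle, positive when [q] is to the left of the line directed
    from [p] to [p']. *)
Definition orient p p' q : R := (p'.1 - p.1) * (q.2 - p.2) - (p'.2 - p.2) * (q.1 - p.1).

(* [lex] replaces the order of first coordinates: this tilts the vertical direction
   infinitesimally, so that no general position is needed. *)
Definition above p p' q : bool :=
  (lex p q (+) lex p' q) && (if lex p p' then orient p p' q < 0 else 0 < orient p p' q).

Definition segpt p p' (s : R) : R * R :=
  ((1 - s) * p.1 + s * p'.1, (1 - s) * p.2 + s * p'.2).

Definition segs_apart p p' q q' : Prop :=
  forall s t, 0 <= s <= 1 -> 0 <= t <= 1 -> segpt p p' s <> segpt q q' t.

Lemma lex_total p q : p != q -> lex q p = ~~ lex p q.
Proof.
case: p q => [p1 p2] [q1 q2]; rewrite /lex xpair_eqE /=.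
by case: (ltgtP p1 q1) => //= _; case: (ltgtP p2 q2).
Qed.

Lemma lex_trans : transitive lex.
Proof.
move=> [q1 q2] [p1 p2] [z1 z2]; rewrite /lex /= => /orP h /orP h'.
case: h => [h|/andP[/eqP h h2]]; case: h' => [h'|/andP[/eqP h' h'2]];
  apply/orP; try (left; lra); right; apply/andP; split; [apply/eqP|]; lra.
Qed.

(** If the first coordinate of the combination ties with that of [p], then [s] is 0 or 1 or both
    ends tie too, and second coordinates decide. *)
Lemma lex_segpt p q q' s : lex p q -> lex p q' -> 0 <= s <= 1 -> lex p (segpt q q' s).
Proof.
move: p q q' => [p1 p2] [q1 q2] [r1 r2]; rewrite /lex /segpt /=.
move=> h h' /andP[s0 s1].
have h1 : p1 <= q1 by case/orP: h => [|/andP[/eqP ->]] //; exact: ltW.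
have h1' : p1 <= r1 by case/orP: h' => [|/andP[/eqP ->]] //; exact: ltW.
have [lt|ge] := ltP p1 ((1 - s) * q1 + s * r1) => //=.
have m1 : 0 <= (1 - s) * (q1 - p1) by apply: mulr_ge0; lra.
have m2 : 0 <= s * (r1 - p1) by apply: mulr_ge0; lra.
have e0 : p1 = (1 - s) * q1 + s * r1 by lra.
rewrite -e0 eqxx /=.
have [s0E|sN0] := eqVneq s 0.
  have E : p1 = q1 by rewrite e0 s0E; ring.
  by move: h; rewrite E ltxx eqxx /= s0E => h; lra.
have [s1E|sN1] := eqVneq s 1.
  have E : p1 = r1 by rewrite e0 s1E; ring.
  by move: h'; rewrite E ltxx eqxx /= s1E => h'; lra.
have s0' : 0 < s by rewrite lt_def sN0.
have s1' : 0 < 1 - s by rewrite subr_gt0 lt_neqAle sN1.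
have n1 : (1 - s) * (q1 - p1) = 0 by lra.
have n2 : s * (r1 - p1) = 0 by lra.
have q1E : q1 = p1.
  by move/eqP: n1; rewrite mulf_eq0 (gt_eqF s1') subr_eq0 => /eqP.
have r1E : r1 = p1.
  by move/eqP: n2; rewrite mulf_eq0 (gt_eqF s0') subr_eq0 => /eqP.
move: h h'; rewrite q1E r1E ltxx eqxx /= => h h'.
have k1 : 0 < (1 - s) * (q2 - p2) by apply: mulr_gt0; lra.
have k2 : 0 < s * (r2 - p2) by apply: mulr_gt0; lra.
lra.
Qed.

Let opp p : R * R := (- p.1, - p.2).

Let lex_opp p q : lex (opp p) (opp q) = lex q p.
Proof. by rewrite /lex /= !ltrN2 eqr_opp eq_sym. Qed.

Lemma segpt_lex p q q' s : lex q p -> lex q' p -> 0 <= s <= 1 -> lex (segpt q q' s) p.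
Proof.
rewrite -lex_opp -(lex_opp _ q') -(lex_opp _ (segpt _ _ _)) => h h' /(lex_segpt h h').
by congr lex; rewrite /segpt /opp /=; congr pair; ring.
Qed.

Lemma orient_segpt p p' q q' s :
  orient p p' (segpt q q' s) = (1 - s) * orient p p' q + s * orient p p' q'.
Proof. by rewrite /orient /segpt /=; ring. Qed.

Lemma orient_swap p p' q : orient p' p q = - orient p p' q.
Proof. by rewrite /orient; ring. Qed.

Lemma on_segment p p' z : lex p z -> lex z p' -> orient p p' z = 0 ->
  exists2 s, 0 <= s <= 1 & z = segpt p p' s.
Proof.
move: p p' z => [p1 p2] [r1 r2] [z1 z2]; rewrite /lex /orient /segpt /= => h h' e.
have h1 : p1 <= z1 by case/orP: h => [|/andP[/eqP ->]] //; exact: ltW.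
have h1' : z1 <= r1 by case/orP: h' => [|/andP[/eqP ->]] //; exact: ltW.
have [E|NE] := eqVneq p1 r1.
  have z1E : z1 = p1 by lra.
  move: h h'; rewrite z1E E !ltxx !eqxx /= => h h'.
  have d : r2 - p2 != 0 by rewrite subr_eq0; apply/eqP; lra.
  have d0 : 0 < r2 - p2 by lra.
  exists ((z2 - p2) / (r2 - p2)).
    by rewrite divr_ge0 ?ler_pdivrMr //; lra.
  by congr pair; field.
have d0 : 0 < r1 - p1 by rewrite subr_gt0 lt_neqAle NE; lra.
have d : r1 - p1 != 0 by rewrite gt_eqF.
exists ((z1 - p1) / (r1 - p1)).
  by rewrite divr_ge0 ?ler_pdivrMr //; lra.
congr pair; first by field.
apply: (mulfI d); have -> : (r1 - p1) * z2 = (r1 - p1) * p2 + (r2 - p2) * (z1 - p1) by lra.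
by field.
Qed.

(** Between points on different sides [orient p p'] has a zero; it is lexicographically between [p]
    and [p'], hence a common point of the segments. *)
Lemma cross_nested p p' q q' : lex p q -> lex p q' -> lex q p' -> lex q' p' ->
  segs_apart p p' q q' -> (orient p p' q < 0) = (orient p p' q' < 0).
Proof.
move=> pq pq' qp' q'p' ap.
have key d d' : d < 0 -> 0 <= d' -> exists2 t : R, 0 <= t <= 1 & (1 - t) * d + t * d' = 0.
  move=> d0 d'0; have D : d - d' != 0 by apply/eqP; lra.
  exists (d / (d - d')); last by field.
  rewrite -mulrNN -invrN; have D0 : 0 < - (d - d') by lra.
  by rewrite divr_ge0 ?ler_pdivrMr //; lra.
have aux t : 0 <= t <= 1 -> (1 - t) * orient p p' q + t * orient p p' q' = 0 -> False.
  move=> t01 e; have [|||s s01 E] := @on_segment p p' (segpt q q' t).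
  - exact: lex_segpt.
  - exact: segpt_lex.
  - by rewrite orient_segpt.
  by case: (ap _ _ s01 t01).
have [d|d] := ltP (orient p p' q) 0.
  have [//|d'] := ltP (orient p p' q') 0.
  by have [t t01 e] := key _ _ d d'; case: (aux t).
have [d'|//] := ltP (orient p p' q') 0.
by have [t t01 e] := key _ _ d' d; case: (aux (1 - t)); lra.
Qed.

(** Directions in the lexicographically positive half-plane are ordered by slope. *)
Lemma cross_trans (u1 u2 m1 m2 v1 v2 : R) : lex (0, 0) (u1, u2) -> lex (0, 0) (m1, m2) ->
  lex (0, 0) (v1, v2) -> 0 < u1 * m2 - u2 * m1 -> 0 < m1 * v2 - m2 * v1 ->
  0 <= u1 * v2 - u2 * v1.
Proof.
rewrite /lex /= => hu hm hv um mv.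
have u0 : 0 <= u1 by case/orP: hu => [/ltW|/andP[/eqP <-]].
have v0 : 0 <= v1 by case/orP: hv => [/ltW|/andP[/eqP <-]].
case/orP: hm => [m0|/andP[/eqP m0 m2p]].
  rewrite -(pmulr_rge0 _ m0).
  have -> : m1 * (u1 * v2 - u2 * v1) = v1 * (u1 * m2 - u2 * m1) + u1 * (m1 * v2 - m2 * v1).
    by ring.
  by apply: addr_ge0; apply: mulr_ge0 => //; exact: ltW.
have : 0 <= m2 * v1 by apply: mulr_ge0 => //; exact: ltW.
by rewrite -m0 in mv *; lra.
Qed.

(** Suppose both orientations have the same sign. Comparing the slopes of the steps from [p] to [q],
    [q] to [p'] and [p'] to [q'] shows that the determinant [D] is at least as large in absolute
    value as their sum, so the intersection point of the two lines lies on both segments. *)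
Lemma cross_overlap p p' q q' : lex p q -> lex q p' -> lex p' q' ->
  segs_apart p p' q q' -> (orient p p' q < 0) (+) (orient q q' p' < 0).
Proof.
move=> pq qp' p'q' ap.
have d1 : orient p p' q != 0.
  apply/eqP => e; have [s s01 E] := on_segment pq qp' e.
  by case: (ap s 0) => //; [lra|rewrite -E /segpt; case: (q) => a b /=; congr pair; ring].
have d2 : orient q q' p' != 0.
  apply/eqP => e; have [s s01 E] := on_segment qp' p'q' e.
  by case: (ap 1 s) => //; [lra|rewrite -E /segpt; case: (p') => a b /=; congr pair; ring].
set D := (p'.1 - p.1) * (q'.2 - q.2) - (p'.2 - p.2) * (q'.1 - q.1).
(* Cramer's rule, with the parameter on the first segment measured from [p']. *)
have meet : D != 0 -> 0 <= - orient p p' q / D <= 1 ->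
    0 <= - orient q q' p' / D <= 1 -> False.
  move=> D0 t01 s01; case: (ap (1 - - orient q q' p' / D) (- orient p p' q / D)) => //.
    by lra.
  rewrite /segpt /orient; move: D0; rewrite /D; case: p p' q q' {pq qp' p'q' ap d1 d2 D t01 s01}.
  by move=> p1 p2 [r1 r2] [q1 q2] [z1 z2] /= D0; congr pair; field.
have lex0 (x y : R * R) : lex x y -> lex (0, 0) (y.1 - x.1, y.2 - x.2).
  by rewrite /lex /= !subr_gt0 [0 == _]eq_sym subr_eq0 eq_sym.
have := cross_trans (lex0 _ _ p'q') (lex0 _ _ qp') (lex0 _ _ pq).
have := cross_trans (lex0 _ _ pq) (lex0 _ _ qp') (lex0 _ _ p'q').
have -> : (q'.1 - p'.1) * (p'.2 - q.2) - (q'.2 - p'.2) * (p'.1 - q.1) = orient q q' p'.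
  by rewrite /orient; ring.
have -> : (p'.1 - q.1) * (q.2 - p.2) - (p'.2 - q.2) * (q.1 - p.1) = orient p p' q.
  by rewrite /orient; ring.
have -> : (q.1 - p.1) * (p'.2 - q.2) - (q.2 - p.2) * (p'.1 - q.1) = - orient p p' q.
  by rewrite /orient; ring.
have -> : (p'.1 - q.1) * (q'.2 - p'.2) - (p'.2 - q.2) * (q'.1 - p'.1) = - orient q q' p'.
  by rewrite /orient; ring.
have -> : (q.1 - p.1) * (q'.2 - p'.2) - (q.2 - p.2) * (q'.1 - p'.1) =
    D + orient p p' q + orient q q' p' by rewrite /D /orient; ring.
have -> : (q'.1 - p'.1) * (q.2 - p.2) - (q'.2 - p'.2) * (q.1 - p.1) =
    - (D + orient p p' q + orient q q' p') by rewrite /D /orient; ring.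
move: (orient p p' q) (orient q q' p') d1 d2 meet => x y x0 y0 meet neg pos.
case: (ltgtP x 0) x0 => // hx _; case: (ltgtP y 0) y0 => // hy _; exfalso.
  have h : 0 <= D + x + y by apply: neg; rewrite oppr_gt0.
  clear neg pos; apply: meet; clear -h hx hy; clearbody D.
  - by rewrite gt_eqF //; lra.
  - by rewrite divr_ge0 ?ler_pdivrMr //; lra.
  - by rewrite divr_ge0 ?ler_pdivrMr //; lra.
have h : 0 <= - (D + x + y) by exact: pos.
clear neg pos; apply: meet; clear -h hx hy; clearbody D.
- by rewrite lt_eqF //; lra.
- by rewrite -mulrNN -invrN divr_ge0 ?ler_pdivrMr //; lra.
- by rewrite -mulrNN -invrN divr_ge0 ?ler_pdivrMr //; lra.
Qed.

Lemma above_sym p p' q : p != q -> p' != q -> above p' p q = above p p' q.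
Proof.
move=> pq p'q; rewrite /above addbC; have [->|NE] := eqVneq p p'; first by [].
rewrite orient_swap (lex_total NE); case: (lex p p') => /=.
  by rewrite oppr_gt0.
by rewrite oppr_lt0.
Qed.

Lemma aboveii p q : above p p q = false.
Proof. by rewrite /above addbb. Qed.

Lemma segs_apart_neq p p' q q' : segs_apart p p' q q' ->
  [/\ p != q, p' != q, p != q' & p' != q'].
Proof.
have s0 a b : segpt a b 0 = a by case: a => x y; rewrite /segpt /=; congr pair; ring.
have s1 a b : segpt a b 1 = b by case: b => x y; rewrite /segpt /=; congr pair; ring.
move=> ap; split; apply/eqP => E.
- by apply: (ap 0 0); rewrite ?s0 ?lexx ?ler01.
- by apply: (ap 1 0); rewrite ?s0 ?s1 ?lexx ?ler01.
- by apply: (ap 0 1); rewrite ?s0 ?s1 ?lexx ?ler01.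
- by apply: (ap 1 1); rewrite ?s0 ?s1 ?lexx ?ler01.
Qed.

Lemma segs_apart_sym p p' q q' : segs_apart p p' q q' -> segs_apart q q' p p'.
Proof. by move=> ap s t s01 t01 /esym; exact: ap. Qed.

Lemma segs_apart_swap p p' q q' : segs_apart p p' q q' -> segs_apart p' p q q'.
Proof.
move=> ap s t s01 t01; have := ap (1 - s) t _ t01; rewrite /segpt.
have -> : 1 - (1 - s) = s by ring.
by rewrite ![s * _ + _]addrC; apply; lra.
Qed.

(** Both sides are symmetric enough to let [p] come first and [q] precede [q']. Then [p'] comes
    before [q], between [q] and [q'], or after [q']: separate, overlapping or nested segments. *)
Lemma segs_parity p p' q q' : segs_apart p p' q q' ->
  (lex p q (+) lex p' q) (+) (lex p q' (+) lex p' q') =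
  (above p p' q (+) above p p' q') (+) (above q q' p (+) above q q' p').
Proof.
wlog pp' : p p' / lex p p' => [WL ap|].
  have [pq p'q pq' p'q'] := segs_apart_neq ap.
  have [->|NE] := eqVneq p p'; first by rewrite !aboveii !addbb.
  case lpp' : (lex p p'); first exact: WL.
  have l : lex p' p by rewrite (lex_total NE) lpp'.
  have := WL _ _ l (segs_apart_swap ap); rewrite (above_sym pq) // (above_sym pq') //.
  by rewrite [above q q' p' (+) _]addbC => <-; congr addb; exact: addbC.
wlog qq' : q q' / lex q q' => [WL ap|].
  have [pq p'q pq' p'q'] := segs_apart_neq ap.
  have [->|NE] := eqVneq q q'; first by rewrite !aboveii !addbb.
  case lqq' : (lex q q'); first exact: WL.
  have l : lex q' q by rewrite (lex_total NE) lqq'.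
  have := WL _ _ l (segs_apart_sym (segs_apart_swap (segs_apart_sym ap))).
  rewrite (@above_sym q q' p) 1?eq_sym // (@above_sym q q' p') 1?eq_sym //.
  by rewrite [above p p' q' (+) _]addbC => <-; exact: addbC.
wlog pq : p p' q q' pp' qq' / lex p q => [WL ap|].
  have [pq p'q pq' p'q'] := segs_apart_neq ap.
  have [l|l] : lex p q \/ lex q p by rewrite (lex_total pq); case: (lex p q); [left|right].
    exact: WL.
  rewrite [RHS]addbC -WL //; last exact: segs_apart_sym.
  rewrite (lex_total pq) (lex_total pq') (lex_total p'q) (lex_total p'q').
  by case: (lex p q); case: (lex p' q); case: (lex p q'); case: (lex p' q').
move=> ap; have [npq p'q pq' p'q'] := segs_apart_neq ap.
have lpq' : lex p q' := lex_trans pq qq'.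
have lqp : lex q p = false by rewrite (lex_total npq) pq.
have lq'p : lex q' p = false by rewrite (lex_total pq') lpq'.
case p'q0 : (lex p' q).
  have p'q1 : lex p' q' := lex_trans p'q0 qq'.
  have qp' : lex q p' = false by rewrite lex_total // p'q0.
  have q'p' : lex q' p' = false by rewrite lex_total // p'q1.
  by rewrite /above pq lpq' p'q0 p'q1 lqp lq'p qp' q'p'.
have qp' : lex q p' by rewrite lex_total // p'q0.
case p'q1 : (lex p' q').
  have q'p' : lex q' p' = false by rewrite lex_total // p'q1.
  have := cross_overlap pq qp' p'q1 ap.
  by rewrite /above pq lpq' p'q0 p'q1 lqp lq'p qp' q'p' pp' qq' /= addbF => ->.
have q'p' : lex q' p' by rewrite lex_total // p'q1.
have := cross_nested pq lpq' qp' q'p' ap.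
by rewrite /above pq lpq' p'q0 p'q1 lqp lq'p qp' q'p' pp' qq' /= => ->; rewrite addbb.
Qed.

End Segments.

Section Polygons.
Local Open Scope ring_scope.
Variable R : realFieldType.
Local Notation point := (R * R)%type.
Implicit Types (p q : point) (s t : seq point).

Fixpoint segs p s : seq (point * point) :=
  if s is p' :: s' then (p, p') :: segs p' s' else [::].

Fixpoint passes_above p s q : bool :=
  if s is p' :: s' then above p p' q (+) passes_above p' s' q else false.

Definition apart p s q t : Prop :=
  forall a b, a \in segs p s -> b \in segs q t -> segs_apart a.1 a.2 b.1 b.2.

(** The relations of two consecutive pieces add up: the terms [m], [n] and [z] of their common point
    cancel. *)
Let glue (a b c d m n x y u w z x' y' : bool) :
  (a (+) m) (+) (c (+) n) = (x (+) y) (+) (u (+) z) ->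
  (m (+) b) (+) (n (+) d) = (x' (+) y') (+) (z (+) w) ->
  (a (+) b) (+) (c (+) d) = ((x (+) x') (+) (y (+) y')) (+) (u (+) w).
Proof.
move=> H1 H2.
have -> : (a (+) b) (+) (c (+) d) = ((a (+) m) (+) (c (+) n)) (+) ((m (+) b) (+) (n (+) d)).
  by move: a b c d m n {H1 H2} => [] [] [] [] [] [].
by rewrite H1 H2; move: x y u w z x' y' {H1 H2} => [] [] [] [] [] [] [].
Qed.

Lemma polygon_segment_parity p s q q' :
  (forall a, a \in segs p s -> segs_apart a.1 a.2 q q') ->
  (lex p q (+) lex (last p s) q) (+) (lex p q' (+) lex (last p s) q') =
  (passes_above p s q (+) passes_above p s q') (+) (above q q' p (+) above q q' (last p s)).
Proof.
elim: s p => [|p' s IH] p ap /=; first by rewrite !addbb.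
apply: glue (segs_parity _) (IH p' _).
  by apply: (ap (p, p')); rewrite inE eqxx.
by move=> a aS; apply: ap; rewrite inE aS orbT.
Qed.

Lemma polygon_parity p s q t : apart p s q t ->
  (lex p q (+) lex (last p s) q) (+) (lex p (last q t) (+) lex (last p s) (last q t)) =
  (passes_above p s q (+) passes_above p s (last q t)) (+)
  (passes_above q t p (+) passes_above q t (last p s)).
Proof.
elim: t q => [|q' t IH] q ap /=; first by rewrite !addbb.
have H1 := polygon_segment_parity (fun a aS => ap a (q, q') aS (mem_head _ _)).
have H2 : apart p s q' t by move=> a b aS bT; apply: ap; rewrite //= inE bT orbT.
move: H1 (IH _ H2); rewrite [X in X = _ -> _]addbACA [X in _ -> X = _ -> _]addbACA.
rewrite [X in _ = X -> _]addbC [X in _ -> _ = X -> _]addbC => H3 H4.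
rewrite [LHS]addbACA [RHS]addbC; exact: glue H3 H4.
Qed.

Lemma segs_cat p s t : segs p (s ++ t) = segs p s ++ segs (last p s) t.
Proof. by elim: s p => //= p' s IH p; rewrite IH. Qed.

End Polygons.

(** * Excluding K33 minors by crossing parity *)

Section K33.
Local Open Scope ring_scope.
Variables (R : realFieldType) (V : finType) (G : rel V).
Hypothesis Gsym : symmetric G.
Variables (pos : V -> R * R) (poly : V -> V -> seq (R * R)).
Hypothesis pos_inj : injective pos.
Hypothesis poly_last : forall u v, G u v -> last (pos u) (poly u v) = pos v.
Hypothesis poly_apart : forall u v u' v', G u v -> G u' v' ->
  [disjoint [:: u; v] & [:: u'; v']] -> apart (pos u) (poly u v) (pos u') (poly u' v').

Fixpoint walk_poly u (p : seq V) : seq (R * R) :=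
  if p is v :: p' then poly u v ++ walk_poly v p' else [::].

Lemma walk_poly_last S u p : path (induced G S) u p ->
  last (pos u) (walk_poly u p) = pos (last u p).
Proof.
elim: p u => //= v p IH u /andP[/and3P[_ _ uv] pp].
by rewrite last_cat poly_last // IH.
Qed.

Lemma walk_poly_segs (S : {set V}) u p a : path (induced G S) u p ->
  a \in segs (pos u) (walk_poly u p) ->
  exists x y, [/\ x \in S, y \in S, G x y & a \in segs (pos x) (poly x y)].
Proof.
elim: p u => //= v p IH u /andP[/and3P[uS vS uv] pp].
rewrite segs_cat mem_cat poly_last // => /orP[aS|]; last exact: IH.
by exists u, v.
Qed.

Lemma walks_parity (S S' : {set V}) u p u' p' : [disjoint S & S'] ->
  path (induced G S) u p -> path (induced G S') u' p' ->
  let g x y := lex (pos x) (pos y) in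
  let c x w y := passes_above (pos x) (walk_poly x w) (pos y) in
  (g u u' (+) g (last u p) u') (+) (g u (last u' p') (+) g (last u p) (last u' p')) =
  (c u p u' (+) c u p (last u' p')) (+) (c u' p' u (+) c u' p' (last u p)).
Proof.
move=> dS pp pp' /=; rewrite -!(walk_poly_last pp) -!(walk_poly_last pp').
apply: polygon_parity => a b /(walk_poly_segs pp)[x [y [xS yS xy ax]]].
move=> /(walk_poly_segs pp')[x' [y' [x'S y'S xy' bx]]].
apply: poly_apart ax bx => //.
have N z : z \in S' -> z \in S = false by move=> zS'; rewrite (disjointFl dS zS').
have NE z z' : z \in S -> z' \in S' -> z != z'.
  by move=> zS z'S; apply/eqP => E; rewrite E N in zS.
by rewrite disjoint_has /= !inE negb_or; rewrite !negb_or !NE.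
Qed.

Let o0 : 'I_3 := @Ordinal 3 0 isT.
Let o1 : 'I_3 := @Ordinal 3 1 isT.
Let o2 : 'I_3 := @Ordinal 3 2 isT.

Let solve (a b c d x y z t : bool) : (a (+) b) (+) (c (+) d) = (x (+) y) (+) (z (+) t) ->
  y (+) t = a (+) (b (+) x) (+) (c (+) z) (+) d.
Proof. by move: a b c d x y z t => [] [] [] [] [] [] [] []. Qed.

(** In the sum over ordered pairs of columns, [c] occurs six times, each [u] and [v] twice, and each
    [h] once with its negation; three ones remain. *)
Let six (c u0 u1 u2 v0 v1 v2 h01 h02 h12 : bool) :
  ((((c (+) u0 (+) v1 (+) h01) (+) (c (+) u1 (+) v0 (+) ~~ h01)) (+)
   ((c (+) u0 (+) v2 (+) h02) (+) (c (+) u2 (+) v0 (+) ~~ h02))) (+)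
   ((c (+) u1 (+) v2 (+) h12) (+) (c (+) u2 (+) v1 (+) ~~ h12))) = true.
Proof. by move: c u0 u1 u2 v0 v1 v2 h01 h02 h12 => [] [] [] [] [] [] [] [] [] []. Qed.

(* The parities of the six pairs of independent edges between rows [i] and [k] of
   K33 add up to [S i + S k = 1], which cannot hold for all three pairs of rows. *)
Lemma no_K33_of_polygons A B : ~ K33_minor G A B.
Proof.
case=> cAB dAB dX tAB.
have : forall i, exists x, x \in A i by move=> i; have [x [y [xA _ _]]] := tAB i i; exists x.
move=> /fin_all_exists[a aA].
have : forall i, exists x, x \in B i by move=> i; have [y [x [_ xB _]]] := tAB i i; exists x.
move=> /fin_all_exists[b bB].
(* An edge of K33 becomes a walk inside the union of its two branch sets, so independent edges give
   walks in disjoint sets. *)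
have : forall ij : 'I_3 * 'I_3, exists p, path (induced G (A ij.1 :|: B ij.2)) (a ij.1) p /\
    last (a ij.1) p = b ij.2.
  move=> [i j] /=; have [cA _] := cAB i; have [_ cB] := cAB j.
  have /(_ (a i) (b j)) := connU Gsym cA cB (tAB i j).
  by rewrite !in_setU aA bB orbT => /(_ isT isT) /connectP[p pp pl]; exists p.
move=> /fin_all_exists[w wP].
pose g x y := lex (pos x) (pos y).
pose X i j y := passes_above (pos (a i)) (walk_poly (a i) (w (i, j))) (pos y).
have dis i j k l : i != k -> j != l -> [disjoint A i :|: B j & A k :|: B l].
  move=> ik jl; have [dA _] := dAB _ _ ik; have [_ dB] := dAB _ _ jl.
  rewrite -setI_eq0 setIUl !setIUr !setU_eq0 !setI_eq0 dA dB !dX /= andbT.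
  by rewrite disjoint_sym dX.
(* The terms are grouped as in [six]: a constant, one depending on [j], one depending on [l], and
   the order of [b j] and [b l]. *)
have E i j k l : i != k -> j != l -> X i j (b l) (+) X k l (b j) =
    g (a i) (a k) (+) (g (b j) (a k) (+) X i j (a k)) (+) (g (a i) (b l) (+) X k l (a i)) (+)
    g (b j) (b l).
  move=> ik jl; have [p1 l1] := wP (i, j); have [p2 l2] := wP (k, l).
  have := walks_parity (dis _ _ _ _ ik jl) p1 p2; rewrite /= in l1 l2 *.
  by rewrite l1 l2; exact: solve.
have gb j l : j != l -> g (b l) (b j) = ~~ g (b j) (b l).
  move=> jl; apply: lex_total; rewrite (inj_eq pos_inj).
  have [_ dB] := dAB _ _ jl; apply/eqP => bjl.
  by have := disjointFr dB (bB j); rewrite bjl bB.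
pose S i := (X i o0 (b o1) (+) X i o1 (b o0)) (+) (X i o0 (b o2) (+) X i o2 (b o0)) (+)
            (X i o1 (b o2) (+) X i o2 (b o1)).
have rows i k : i != k -> S i (+) S k = true.
  move=> ik.
  have := six (g (a i) (a k)) (g (b o0) (a k) (+) X i o0 (a k)) (g (b o1) (a k) (+) X i o1 (a k))
    (g (b o2) (a k) (+) X i o2 (a k)) (g (a i) (b o0) (+) X k o0 (a i))
    (g (a i) (b o1) (+) X k o1 (a i)) (g (a i) (b o2) (+) X k o2 (a i))
    (g (b o0) (b o1)) (g (b o0) (b o2)) (g (b o1) (b o2)).
  rewrite -!gb // -!E // => <-; rewrite /S.
  move: (X i o0 (b o1)) (X i o1 (b o0)) (X i o0 (b o2)) (X i o2 (b o0)) (X i o1 (b o2))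
    (X i o2 (b o1)) (X k o0 (b o1)) (X k o1 (b o0)) (X k o0 (b o2)) (X k o2 (b o0))
    (X k o1 (b o2)) (X k o2 (b o1)).
  by move=> [] [] [] [] [] [] [] [] [] [] [] [].
have := rows o0 o1 isT; have := rows o1 o2 isT; have := rows o0 o2 isT.
by case: (S o0); case: (S o1); case: (S o2).
Qed.

End K33.

(** * Polygonal approximation of a plane drawing *)

Section Sampling.
Local Open Scope ring_scope.
Local Open Scope classical_set_scope.
Variable R : realType.
Implicit Types f g : R -> R * R.

Lemma within_gt f (h : R * R -> R) (x c : R) : {within `[0, 1], continuous f} ->
  continuous h -> 0 <= x <= 1 -> c < h (f x) ->
  exists2 e : R, 0 < e & forall y, 0 <= y <= 1 -> `|x - y| < e -> c < h (f y).
Proof.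
move=> /subspace_continuousP cf ch x01 cx.
have xI : `[0, 1]%classic x by rewrite /= in_itv.
have : (h \o f) @ within `[0, 1] (nbhs x) --> h (f x).
  by apply: cvg_comp (cf x xI) (ch _).
move=> /cvgr_gt /(_ _ cx); rewrite near_withinE => /nbhs_ballP[e e0 eP].
by exists e => // y y01 xy; apply: (eP y); rewrite //= in_itv.
Qed.

(** Some coordinate [h] differs at the two points. By continuity nearby points stay on their sides
    of the level midway between, and half-planes are convex. *)
Lemma local_apart f g (s0 t0 : R) :
  {within `[0, 1], continuous f} -> {within `[0, 1], continuous g} ->
  0 <= s0 <= 1 -> 0 <= t0 <= 1 -> f s0 <> g t0 ->
  exists2 e : R, 0 < e & forall s s' t t', 0 <= s <= 1 -> 0 <= s' <= 1 -> 0 <= t <= 1 ->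
    0 <= t' <= 1 -> `|s0 - s| < e -> `|s0 - s'| < e -> `|t0 - t| < e -> `|t0 - t'| < e ->
    segs_apart (f s) (f s') (g t) (g t').
Proof.
move=> cf cg s01 t01 fg.
have main (h : R * R -> R) : continuous h ->
    (forall p p' s, h (segpt p p' s) = (1 - s) * h p + s * h p') -> h (f s0) != h (g t0) ->
  exists2 e : R, 0 < e & forall s s' t t', 0 <= s <= 1 -> 0 <= s' <= 1 -> 0 <= t <= 1 ->
    0 <= t' <= 1 -> `|s0 - s| < e -> `|s0 - s'| < e -> `|t0 - t| < e -> `|t0 - t'| < e ->
    segs_apart (f s) (f s') (g t) (g t').
  move=> ch hE NE.
  wlog lt : f g s0 t0 cf cg s01 t01 fg NE / h (f s0) < h (g t0) => [WL|].
    have [lt|gt|E] := ltgtP (h (f s0)) (h (g t0)).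
    - exact: WL.
    - have [||e e0 eP] := WL g f t0 s0 cg cf t01 s01 _ _ gt; first by move=> /esym.
        by rewrite eq_sym.
      by exists e => // *; apply: segs_apart_sym; exact: eP.
    - by rewrite E eqxx in NE.
  pose c := (h (f s0) + h (g t0)) / 2.
  have cN : continuous (fun p => - h p) by move=> p; exact: continuousN (ch p).
  have [|e1 e10 P1] := within_gt (c := - c) cf cN s01; first by rewrite ltrN2 /c; lra.
  have [|e2 e20 P2] := within_gt (c := c) cg ch t01; first by rewrite /c; lra.
  exists (Num.min e1 e2); first by rewrite lt_min e10.
  move=> s s' t t' hs hs' ht ht'; rewrite !lt_min => /andP[sd _] /andP[sd' _] /andP[_ td].
  move=> /andP[_ td'] a b a01 b01 E.
  have := P1 _ hs sd; have := P1 _ hs' sd'; have := P2 _ ht td; have := P2 _ ht' td'.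
  have := hE (f s) (f s') a; rewrite E hE /= !ltrN2.
  move: (h (g t)) (h (g t')) (h (f s)) (h (f s')) => x1 x2 x3 x4 E' l2 l1 l4 l3.
  clear -a01 b01 E' l1 l2 l3 l4; clearbody c; case/andP: a01 b01 => a0 a1 /andP[b0 b1].
  have m1 : 0 <= (1 - a) * (c - x3) by apply: mulr_ge0; lra.
  have m2 : 0 <= a * (c - x4) by apply: mulr_ge0; lra.
  have [bE|bN] := eqVneq b 0; first by rewrite bE in E'; lra.
  have m3 : 0 <= (1 - b) * (x1 - c) by apply: mulr_ge0; lra.
  have m4 : 0 < b * (x2 - c) by rewrite mulr_gt0 ?subr_gt0 // lt_def bN.
  by lra.
have [E1|NE1] := eqVneq (f s0).1 (g t0).1; last first.
  by apply: (main fst) => //; by move=> -[x y]; exact: cvg_fst.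
have NE2 : (f s0).2 != (g t0).2.
  apply/eqP => E2; apply: fg; move: E1 E2.
  by case: (f s0) (g t0) => [a b] [c d] /= -> ->.
by apply: (main snd) => //; by move=> -[x y]; exact: cvg_snd.
Qed.

(** Compactness of the unit square makes the radius of [local_apart] uniform. *)
Lemma uniform_apart f g :
  {within `[0, 1], continuous f} -> {within `[0, 1], continuous g} ->
  (forall s t, 0 <= s <= 1 -> 0 <= t <= 1 -> f s <> g t) ->
  exists N : nat, forall n, (N <= n)%N -> forall s s' t t',
    0 <= s <= 1 -> 0 <= s' <= 1 -> 0 <= t <= 1 -> 0 <= t' <= 1 ->
    `|s - s'| < n.+1%:R^-1 -> `|t - t'| < n.+1%:R^-1 -> segs_apart (f s) (f s') (g t) (g t').
Proof.
move=> cf cg fg.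
have /compact_near_coveringP/near_covering_withinP :=
  compact_setX (@segment_compact R 0 1) (@segment_compact R 0 1).
move=> /(_ nat \oo (fun n st => forall s' t', 0 <= s' <= 1 -> 0 <= t' <= 1 ->
  `|st.1 - s'| < n.+1%:R^-1 -> `|st.2 - t'| < n.+1%:R^-1 ->
  segs_apart (f st.1) (f s') (g st.2) (g t')) _).
case.
  move=> [s0 t0] /= []; rewrite !in_itv /= => s01 t01.
  have [e e0 eP] := local_apart cf cg s01 t01 (fg _ _ s01 t01).
  have e20 : 0 < e / 2 by lra.
  (* Half of the radius is for the distance of [s] from [s0], the other half for that of [s'] from
     [s]. *)
  exists (ball (s0, t0) (e / 2), [set n | n.+1%:R^-1 < e / 2]).
    split; first exact: nbhsx_ballx.
    exact: near_infty_natSinv_lt (PosNum e20).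
  move=> [[s t] n] /= [[/= bs bt] ne] []; rewrite !in_itv /= => hs ht s' t' hs' ht' ds dt; rewrite /= in ne.
  have tri (x y z : R) : `|x - y| < e / 2 -> `|y - z| < n.+1%:R^-1 -> `|x - z| < e.
    move=> xy yz; rewrite -(subrKA y); apply: le_lt_trans (ler_normD _ _) _.
    by rewrite [e]splitr; apply: ltrD xy (lt_trans yz ne).
  have half (x y : R) : `|x - y| < e / 2 -> `|x - y| < e by move=> h; lra.
  by apply: eP => //; [exact: half|exact: tri bs ds|exact: half|exact: tri bt dt].
move=> N _ NP; exists N => n Nn s s' t t' hs hs' ht ht' ds dt.
by apply: (NP n Nn (s, t)); rewrite //= !in_itv.
Qed.

End Sampling.

Section Samples.
Local Open Scope ring_scope.
Variable R : realType.
Implicit Types f g : R -> R * R.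

(** The starting point [f 0] is left out, because [segs] takes it as a separate argument. *)
Definition samples f m : seq (R * R) := [seq f (i%:R / m%:R) | i <- iota 1%N m].

Lemma samples_segs f m k n a :
  a \in segs (f (k%:R / m%:R)) [seq f (i%:R / m%:R) | i <- iota k.+1 n] ->
  exists2 i : nat, (i < k + n)%N & a = (f (i%:R / m%:R), f (i.+1%:R / m%:R)).
Proof.
elim: n k => //= n IH k; rewrite inE => /orP[/eqP ->|/IH[i lt_i ->]].
  by exists k; rewrite // addnS ltnS leq_addr.
by exists i; rewrite // addnS -addSn.
Qed.

Lemma samples_last f m : (0 < m)%N -> last (f 0) (samples f m) = f 1.
Proof.
case: m => // m _; rewrite /samples -addn1 iotaD map_cat last_cat /= add1n.
by rewrite addn1 divff // pnatr_eq0.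
Qed.

Lemma samples_apart f g : {within `[0, 1], continuous f}%classic ->
  {within `[0, 1], continuous g}%classic ->
  (forall s t, 0 <= s <= 1 -> 0 <= t <= 1 -> f s <> g t) ->
  exists N, forall m, (N < m)%N -> apart (f 0) (samples f m) (g 0) (samples g m).
Proof.
move=> cf cg fg; have [N NP] := uniform_apart cf cg fg.
(* With [m.+2] samples the mesh is strictly below [m.+1%:R^-1], so [uniform_apart] is applied at
   index [m]. *)
exists N.+1 => -[//|[//|m]] lt_Nm a b.
have m0 : 0 < m.+2%:R :> R by rewrite ltr0n.
have h0 (h : R -> R * R) : h 0 = h (0%:R / m.+2%:R) by rewrite mul0r.
have unit i : (i < 0 + m.+2)%N -> [/\ 0 <= (i%:R / m.+2%:R : R) <= 1,
    0 <= (i.+1%:R / m.+2%:R : R) <= 1 &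
    `|(i%:R / m.+2%:R : R) - i.+1%:R / m.+2%:R| < m.+1%:R^-1].
  rewrite add0n => lt_im; rewrite !divr_ge0 ?ler0n // !ler_pdivrMr // !mul1r !ler_nat lt_im ltnW //.
  split=> //; rewrite -mulrBl -natr1 opprD addrA subrr sub0r mulN1r normrN.
  by rewrite gtr0_norm ?invr_gt0 // ltf_pV2 ?posrE ?ltr0n // ltr_nat.
rewrite (h0 f) (h0 g) => /samples_segs[i /unit[i0 i1 di] ->] /samples_segs[j /unit[j0 j1 dj] ->].
by rewrite !ltnS in lt_Nm; exact: (NP m lt_Nm _ _ _ _ i0 i1 j0 j1 di dj).
Qed.

End Samples.

Section Planar.
Local Open Scope ring_scope.
Variables (R : realType) (V : finType) (G : sgraph V).
Variables (pos : V -> R * R) (arc : {set V} -> R -> R * R).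
Hypothesis D : plane_drawing G pos arc.

(** An arc belongs to an unordered edge; it is reversed if it does not start at [pos u]. *)
Definition curve (u v : V) (t : R) : R * R :=
  let e := [set u; v]%SET in if arc e 0 == pos u then arc e t else arc e (1 - t).

Lemma edge_set u v : G u v -> [set u; v]%SET \in edges G.
Proof. by move=> uv; apply/imsetP; exists (u, v) => //; rewrite inE. Qed.

Lemma arc_ends u v : G u v ->
  (arc [set u; v]%SET 0 = pos u /\ arc [set u; v]%SET 1 = pos v) \/
  (arc [set u; v]%SET 0 = pos v /\ arc [set u; v]%SET 1 = pos u).
Proof.
move=> uv; have [pinj Darc _ _] := D; have [_ ainj aE] := Darc _ (edge_set uv).
have I0 : (0 : R) \in `[0, 1] by rewrite in_itv /= lexx ler01.
have I1 : (1 : R) \in `[0, 1] by rewrite in_itv /= lexx ler01.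
have N01 : arc [set u; v]%SET 0 <> arc [set u; v]%SET 1.
  by move=> /(ainj _ _ I0 I1)/esym/eqP; rewrite oner_eq0.
have end_of t : t = 0 \/ t = 1 ->
    arc [set u; v]%SET t = pos u \/ arc [set u; v]%SET t = pos v.
  move=> t01; have : (pos @` [set` [set u; v]%SET])%classic (arc [set u; v]%SET t).
    by rewrite -aE; exists t.
  by case=> w /= /set2P[->|->] <-; [left|right].
have [E0|E0] := end_of 0 (or_introl erefl); have [E1|E1] := end_of 1 (or_intror erefl).
- by case: N01; rewrite E0 E1.
- by left.
- by right.
- by case: N01; rewrite E0 E1.
Qed.

Lemma curve_ends u v : G u v -> curve u v 0 = pos u /\ curve u v 1 = pos v.
Proof.
move=> uv; have uNv : u != v by apply: contraTneq uv => ->; rewrite adj_irrefl.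
have [pinj _ _ _] := D; rewrite /curve.
case: (arc_ends uv) => -[E0 E1]; first by rewrite E0 eqxx.
by rewrite E0 (inj_eq pinj) eq_sym (negbTE uNv) subr0 subrr.
Qed.

Lemma curve_cont u v : G u v -> {within `[0, 1], continuous (curve u v)}%classic.
Proof.
move=> uv; have [_ Darc _ _] := D; have [ca _ _] := Darc _ (edge_set uv).
rewrite /curve; case: (_ == _) => //; move: ca => /subspace_continuousP ca.
apply/subspace_continuousP => x /= x01.
have y01 : `[0, 1]%classic (1 - x) by move: x01; rewrite /= !in_itv /= => h; lra.
have c : {for x, continuous (fun y : R => 1 - y)}.
  by apply: continuousB; [exact: cvg_cst|exact: cvg_id].
apply: (cvg_comp (fun y : R => 1 - y) _ _ (ca _ y01)) => A wA.
have H : nbhs x ((fun y : R => 1 - y) @^-1` [set z | `[0, 1]%classic z -> A z])%classic.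
  exact: c wA.
rewrite /= /within /=; near_simpl; apply: filterS H => y /= h yI; apply: h.
by move: yI; rewrite !in_itv /= => yI; lra.
Qed.

(** The drawing separates inner points of either arc from the whole other arc; two end points differ
    because [pos] is injective. *)
Lemma curve_disjoint u v u' v' (s t : R) : G u v -> G u' v' ->
  [disjoint [:: u; v] & [:: u'; v']] -> 0 <= s <= 1 -> 0 <= t <= 1 ->
  curve u v s <> curve u' v' t.
Proof.
move=> uv uv' dis s01 t01.
have [pinj Darc _ Dcross] := D.
have arc_of a b (x : R) : 0 <= x <= 1 -> exists2 y, 0 <= y <= 1 & curve a b x = arc [set a; b]%SET y.
  by move=> x01; rewrite /curve; case: ifP => _; [exists x|exists (1 - x) => //; lra].
have [y y01 ->] := arc_of u v s s01; have [z z01 ->] := arc_of u' v' t t01.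
have NE w : w \in [set u; v]%SET -> w \in [set u'; v']%SET -> False.
  by rewrite !inE => h1 h2; have := disjointFr dis (x := w); rewrite !inE h1 h2 => /(_ isT).
have eNf : [set u; v]%SET != [set u'; v']%SET.
  by apply/eqP => E; apply: (NE u); rewrite -?E !inE eqxx.
have inner (x : R) : 0 <= x <= 1 -> [\/ (x \in `]0, 1[), x = 0 | x = 1].
  move=> /andP[x0 x1]; rewrite in_itv /=.
  have [->|x0'] := eqVneq x 0; first by apply: Or32.
  have [->|x1'] := eqVneq x 1; first by apply: Or33.
  by apply: Or31; rewrite !lt_def x0 x1 x0' eq_sym x1'.
have I (a : R) : 0 <= a <= 1 -> a \in `[0, 1] by rewrite in_itv.
have ends a b x : G a b -> x = 0 \/ x = 1 ->
    exists2 w, w \in [set a; b]%SET & arc [set a; b]%SET x = pos w.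
  move=> ab x01; case: (arc_ends ab) => -[E0 E1]; case: x01 => ->; rewrite ?E0 ?E1.
  - by exists a; rewrite // !inE eqxx.
  - by exists b; rewrite // !inE eqxx orbT.
  - by exists b; rewrite // !inE eqxx orbT.
  - by exists a; rewrite // !inE eqxx.
have e1 := edge_set uv; have e2 := edge_set uv'.
have [yi|y0] : (y \in `]0, 1[) \/ (y = 0 \/ y = 1) by case: (inner y y01); tauto.
  exact: (Dcross _ _ y z e1 e2 eNf yi (I _ z01)).
have [zi|z0] : (z \in `]0, 1[) \/ (z = 0 \/ z = 1) by case: (inner z z01); tauto.
  by move/esym; apply: (Dcross _ _ z y e2 e1 _ zi (I _ y01)); rewrite eq_sym.
have [w wE ->] := ends u v y uv y0; have [w' wE' ->] := ends u' v' z uv' z0.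
by move=> /pinj E; apply: (NE w) => //; rewrite E.
Qed.

Lemma drawing_no_K33 A B : ~ K33_minor G A B.
Proof.
have [pinj _ _ _] := D.
have : forall q : (V * V) * (V * V), exists N, forall m, (N < m)%N ->
    G q.1.1 q.1.2 -> G q.2.1 q.2.2 -> [disjoint [:: q.1.1; q.1.2] & [:: q.2.1; q.2.2]] ->
    apart (curve q.1.1 q.1.2 0) (samples (curve q.1.1 q.1.2) m)
          (curve q.2.1 q.2.2 0) (samples (curve q.2.1 q.2.2) m).
  move=> [[u v] [u' v']] /=.
  have [/and3P[uv uv' dis]|nq] :=
    boolP [&& G u v, G u' v' & [disjoint [:: u; v] & [:: u'; v']]]; last first.
    by exists 0%N => m _ uv uv' dis; rewrite uv uv' dis in nq.
  have [|N NP] := samples_apart (curve_cont uv) (curve_cont uv').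
    by move=> s t; exact: curve_disjoint.
  by exists N => m /NP.
move=> /fin_all_exists[N NP].
(* One number of samples that is fine enough for all pairs of edges. *)
pose m := (\max_q N q).+1.
apply: (@no_K33_of_polygons _ _ _ (@adj_sym _ G) pos (fun u v => samples (curve u v) m)) => //.
  by move=> u v uv; have [<- <-] := curve_ends uv; rewrite samples_last.
move=> u v u' v' uv uv' dis.
have [<- _] := curve_ends uv; have [<- _] := curve_ends uv'.
by apply: (NP ((u, v), (u', v'))) => //; rewrite ltnS leq_bigmax.
Qed.

End Planar.

(** * The six graphs *)

Section Assembly.
Variables (V : finType) (G : sgraph V).

Definition cut_rel (c : V -> bool) : rel V := fun x y => (x != y) && (G x y || (c x == c y)).

Lemma cut_sym c : symmetric (cut_rel c).
Proof. by move=> x y; rewrite /cut_rel eq_sym adj_sym (eq_sym (c x)). Qed.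

Lemma cut_irrefl c : irreflexive (cut_rel c).
Proof. by move=> x; rewrite /cut_rel eqxx. Qed.

Definition cut c : sgraph V := SGraph (@cut_sym c) (@cut_irrefl c).

Lemma cut_cobipartite c : cobipartite (cut c).
Proof.
pose h : rel V := fun x y => ~~ G x y && (c x != c y).
have hs : symmetric h by move=> x y; rewrite /h adj_sym eq_sym.
have hi : irreflexive h by move=> x; rewrite /h eqxx andbF.
exists (SGraph hs hi); first by exists c => x y /andP[].
by move=> x y; rewrite /= /cut_rel /compl_rel /= /h negb_and !negbK.
Qed.

Definition layers_rel (lay : V -> nat) : rel V :=
  fun x y => [&& x != y, (lay x <= (lay y).+1)%N & (lay y <= (lay x).+1)%N].

Lemma layers_sym lay : symmetric (layers_rel lay).
Proof. by move=> x y; rewrite /layers_rel eq_sym [X in _ && X]andbC. Qed.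

Lemma layers_irrefl lay : irreflexive (layers_rel lay).
Proof. by move=> x; rewrite /layers_rel eqxx. Qed.

Definition layers lay : sgraph V := SGraph (@layers_sym lay) (@layers_irrefl lay).

Lemma layers_unit_interval (R : realType) lay : unit_interval_graph R (layers lay).
Proof.
exists (fun x => (lay x)%:R%R) => x y xy; rewrite /= /layers_rel xy /=.
rewrite -!(ler_nat R) -!natr1; split.
  (* If two intervals meet, the larger left end point is common to both. *)
  move=> /andP[h1 h2]; exists (Num.max (lay x)%:R (lay y)%:R)%R.
  by rewrite /= !in_itv /= !le_max !ge_max !lexx !orbT /= !lerDl !ler01 h1 h2.
by case=> z; rewrite /= !in_itv /= => -[/andP[h1 h2] /andP[h3 h4]]; apply/andP; split; lra.
Qed.

Variables (B : V -> {set V}) (rho : V -> nat).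
Hypothesis Blt : forall x y, y \in B x -> (rho y < rho x)%N.
Hypothesis Bclique : forall x y z, y \in B x -> z \in B x -> y != z ->
  (y \in B z) || (z \in B y).

Definition fill_rel : rel V := fun x y => (x \in B y) || (y \in B x).

Lemma fill_sym : symmetric fill_rel.
Proof. by move=> x y; rewrite /fill_rel orbC. Qed.

Lemma fill_irrefl : irreflexive fill_rel.
Proof. by move=> x; rewrite /fill_rel orbb; apply/negP => /Blt; rewrite ltnn. Qed.

Definition fill : sgraph V := SGraph fill_sym fill_irrefl.

(* The two neighbours on the cycle of the vertex added last both belong to its
   clique of earlier neighbours. *)
Lemma fill_chordal : chordal fill.
Proof.
move=> k f k4 [finj fE].
have k0 : (0 < k)%N by apply: leq_trans k4.
case: (@arg_maxnP _ (Ordinal k0) predT (rho \o f) isT) => i _ imax.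
pose j := ordS i; pose j' := ord_pred i.
have jB t : fill (f i) (f t) -> f t \in B (f i).
  case/orP => // /Blt; rewrite ltnNge; have /= -> := imax t isT; by [].
have Bj : f j \in B (f i) by apply: jB; rewrite fE eqxx.
have Bj' : f j' \in B (f i) by apply: jB; rewrite fE ord_predK eqxx orbT.
(* Shifts of the cycle by 1, 2 and 3 have no fixed point as [k] is at least 4; so [j] and [j'] are
   distinct and not consecutive. *)
have val3 (a b : 'I_k) n : (0 < n < k)%N -> iter n (@ordS k) a = b -> a != b.
  move=> /andP[n0 nk] E; apply/eqP => ab.
  have iterE m : iter m (@ordS k) a = ((a + m) %% k)%N :> nat.
    elim: m => [|m IH]; first by rewrite addn0 modn_small.
    by rewrite iterS /= IH -addn1 modnDml addn1 addnS.
  have := iterE n; rewrite E -ab => Ea.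
  have : (a + 0 == a + n %[mod k])%N by rewrite addn0 modn_small // -Ea.
  by rewrite eqn_modDl mod0n modn_small // eq_sym (gtn_eqF n0).
have i_j' : ordS j' = i by exact: ord_predK.
have j'j : j' != j by apply: (val3 _ _ 2%N); rewrite /= ?i_j' //; apply: leq_trans k4.
have jj' : j != j' by rewrite eq_sym.
have : fill (f j) (f j').
  by apply: (Bclique Bj Bj'); rewrite (inj_eq finj).
rewrite fE => /orP[/eqP E|].
  have : j' != j' by apply: (val3 _ _ 3%N); rewrite /= ?i_j' -?E.
  by rewrite eqxx.
rewrite i_j'; apply/negP; rewrite eq_sym; apply: (val3 _ _ 1%N) => //.
exact: leq_trans k4.
Qed.

End Assembly.

Lemma bits8_inj (c d : 'I_8) : odd c = odd d -> odd c./2 = odd d./2 ->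
  odd c./2./2 = odd d./2./2 -> c = d.
Proof.
by move=> h1 h2 h3; apply: val_inj; move: c d h1 h2 h3;
  do 2![case=> [[|[|[|[|[|[|[|[|//]]]]]]]] ?]].
Qed.

Theorem theorem6 (R : realType) (V : finType) (G : sgraph V) :
  sg_connected G -> planar R G ->
  exists G1 G2 G3 G4 G5 G6 : sgraph V,
    [/\ [/\ cobipartite G1, cobipartite G2, cobipartite G3 & cobipartite G4],
        unit_interval_graph R G5,
        chordal G6 &
        forall x y : V,
          G x y = [&& G1 x y, G2 x y, G3 x y, G4 x y, G5 x y & G6 x y]].
Proof.
move=> Gc [pos [arc D]].
have Gs := @adj_sym _ G; have Gi := @adj_irrefl _ G.
(* Without vertices there is no root, and the claim is trivial. *)
have [r _|V0] := pickP (pred_of_simpl (@predT V)); last first.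
  exists (cut G xpredT), (cut G xpredT), (cut G xpredT), (cut G xpredT), (layers (fun=> 0%N)), G.
  split=> [||k f k4|x y]; [|exact: layers_unit_interval| |by have := V0 x].
    by split; exact: cut_cobipartite.
  by have := V0 (f (Ordinal (leq_trans (isT : (0 < 4)%N) k4))).
have [par [lay [T layS]]] := bfs_tree r Gs Gc.
have cT : conn G [set: V].
  move=> x y _ _; apply: connect_sub (Gc x y) => u v uv.
  by apply: connect1; rewrite /induced !in_setT.
have noK33 := drawing_no_K33 D.
have [B [rho [_ Blt Bcl Bedge Bcard]]] :
    exists B rho, elimination G lay 8 [set: V] B rho.
  (* Regions avoid the root, so the full vertex set is added as the starting case. *)
  apply: (splits_elimination Gs Gi (P := fun X => X = [set: V] \/ region G par X)).
    move=> X X0 [->|RX].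
      have [M [MX M0 cM PM]] := setT_splits Gs T.
      by exists M; split=> // x /PM; right.
    have [M [MX M0 cM PM]] := region_splits Gs T noK33 cT X0 RX.
    by exists M; split=> // x /PM; right.
  by left.
have Blt' x y : y \in B x -> (rho y < rho x)%N by apply: Blt; rewrite in_setT.
(* The full vertex set has no outside neighbours, so the first alternative of [elim_clique] cannot
   occur. *)
have Bcl' x y z : y \in B x -> z \in B x -> y != z -> (y \in B z) || (z \in B y).
  move=> yB zB NE; have := Bcl x y z (in_setT x) yB zB NE.
  by rewrite !in_setT /= => /orP[/andP[/nbP[]]|//]; rewrite in_setT.
have [c cP] := greedy_coloring Blt' (fun x => Bcard x (in_setT x)).
exists (cut G (fun x => odd (lay x))), (cut G (fun x => odd (c x))),
  (cut G (fun x => odd (c x)./2)), (cut G (fun x => odd (c x)./2./2)),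
  (layers lay), (fill Blt'); split.
- by split; exact: cut_cobipartite.
- exact: layers_unit_interval.
- exact: fill_chordal.
move=> x y; have [xy|xy] := boolP (G x y).
  have NE : x != y by apply: contraTneq xy => ->; rewrite Gi.
  rewrite /= /cut_rel /layers_rel /fill_rel xy NE !layS // 1?Gs //=.
  by have := Bedge x y (in_setT x) xy; rewrite in_setT orbC => ->.
apply/esym/negP => /=; rewrite /cut_rel /layers_rel /fill_rel (negbTE xy) /=.
case/and5P=> /andP[NE /eqP e0] /andP[_ /eqP e1] /andP[_ /eqP e2] /andP[_ /eqP e3].
case/andP=> /and3P[_ l1 l2] xyB.
(* The layers differ by at most one and have the same parity. *)
have E : lay x = lay y.
  apply/eqP; rewrite eqn_leq; move: l1 l2; rewrite [in X in X -> _]leq_eqVlt ltnS.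
  case/orP=> [/eqP E|->]; first by move: e0; rewrite E /=; case: (odd _).
  rewrite leq_eqVlt ltnS => /orP[/eqP E|//].
  by move: e0; rewrite E /=; case: (odd _).
have cE := bits8_inj e1 e2 e3.
by case/orP: xyB => /cP; rewrite E cE eqxx => /(_ erefl).
Qed.
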